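(* Let $G$ be a group generated by a set of $3$ elements, and suppose that the cost of $G$ satisfies $\mathcal{C}(G)\geq 5/2$. Then: (i) $\mathcal{T}(G)\leq 6$; in particular, if $G$ is a torsion group, then $\mathcal{T}(G)=6$. (ii) If in addition one of the $3$ generators has infinite order, then $\mathcal{T}(G)\leq 5$; in particular, if moreover $G$ does not contain a non-abelian free subgroup, then $\mathcal{T}(G)=5$.
   Context: Tarski number: a group $G$ admits a paradoxical decomposition if there exist positive integers $m,n$, pairwise disjoint subsets $P_1,\ldots,P_m,Q_1,\ldots,Q_n$ of $G$ and elements $g_1,\ldots,g_m,h_1,\ldots,h_n\in G$ with $G=\bigcup_{i=1}^m P_ig_i=\bigcup_{j=1}^n Q_jh_j$; $\mathcal{T}(G)$ is the minimal value of $m+n$ (defined for non-amenable $G$). Cost: let $G$ be a countable group and let $G$ act on a standard Borel probability space $(X,\mu)$ by measure-preserving Borel maps, almost surely freely. A graphing of the action is a countable family of Borel bijections $\phi_i\colon A_i\to B_i$ between Borel subsets of $X$ with $\phi_i(x)\in G\cdot x$ for all $x\in A_i$, such that the connected components of the graph on $X$ with edges $\{x,\phi_i(x)\}$ ($x\in A_i$) are almost surely the $G$-orbits. Its cost is $\sum_i\mu(A_i)$; the cost of the action is the infimum of the costs of its graphings, and the cost $\mathcal{C}(G)$ of the group is the infimum of the costs of all such actions of $G$. *)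

(* Defs.v *)
From HB Require Import structures.
From mathcomp Require Import all_boot all_order all_algebra.
From mathcomp Require Import all_classical all_reals all_analysis.
From mathcomp Require Import Rstruct.
Set Implicit Arguments. Unset Strict Implicit. Unset Printing Implicit Defensive.
Import Order.TTheory GRing.Theory Num.Theory.
Local Open Scope classical_set_scope.
Local Open Scope ring_scope.

Notation Rr := Rdefinitions.R.

Record group := Group {
  gcar :> Type;
  gmul : gcar -> gcar -> gcar;
  gone : gcar;
  ginv : gcar -> gcar;
  gmulA : forall x y z, gmul x (gmul y z) = gmul (gmul x y) z;
  gmul1l : forall x, gmul gone x = x;
  gmul1r : forall x, gmul x gone = x;
  gmulVl : forall x, gmul (ginv x) x = gone;
  gmulVr : forall x, gmul x (ginv x) = gone }.

Inductive generated (G : group) (S : G -> Prop) : G -> Prop :=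
| gen_base x : S x -> generated S x
| gen_one : generated S (gone G)
| gen_mul x y : generated S x -> generated S y -> generated S (gmul x y)
| gen_inv x : generated S x -> generated S (ginv x).

Definition generated_by3 (G : group) (a b c : G) : Prop :=
  forall x : G, generated (fun y => y = a \/ y = b \/ y = c) x.

Fixpoint gpow (G : group) (x : G) (n : nat) : G :=
  match n with O => gone G | S k => gmul x (gpow x k) end.

Definition infinite_order (G : group) (x : G) : Prop :=
  forall n : nat, (0 < n)%N -> gpow x n <> gone G.

Definition torsion_group (G : group) : Prop :=
  forall x : G, exists n : nat, (0 < n)%N /\ gpow x n = gone G.

Definition letter_eval (G : group) (a b : G) (l : bool * bool) : G :=
  let g := if l.1 then b else a in if l.2 then ginv g else g.

Fixpoint word_eval (G : group) (a b : G) (w : seq (bool * bool)) : G :=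
  match w with
  | [::] => gone G
  | l :: w' => gmul (letter_eval a b l) (word_eval a b w')
  end.

Fixpoint reduced_word (w : seq (bool * bool)) : bool :=
  match w with
  | l1 :: ((l2 :: _) as w') => ~~ ((l1.1 == l2.1) && (l1.2 != l2.2)) && reduced_word w'
  | _ => true
  end.

Definition contains_free_subgroup (G : group) : Prop :=
  exists a b : G, forall w, w != [::] -> reduced_word w -> word_eval a b w <> gone G.

Definition rtranslate (G : group) (P : set G) (g : G) : set G :=
  [set gmul p g | p in P].

Definition paradoxical_decomposition (G : group) (m n : nat) : Prop :=
  (0 < m)%N /\ (0 < n)%N /\
  exists (P : nat -> set G) (Q : nat -> set G) (g h : nat -> G),
    (forall i j, (i < m)%N -> (j < m)%N -> i <> j -> P i `&` P j = set0) /\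
    (forall i j, (i < n)%N -> (j < n)%N -> i <> j -> Q i `&` Q j = set0) /\
    (forall i j, (i < m)%N -> (j < n)%N -> P i `&` Q j = set0) /\
    \bigcup_(i in [set k | (k < m)%N]) rtranslate (P i) (g i) = setT /\
    \bigcup_(j in [set k | (k < n)%N]) rtranslate (Q j) (h j) = setT.

Definition tarski_le (G : group) (k : nat) : Prop :=
  exists m n, (m + n <= k)%N /\ paradoxical_decomposition G m n.

Definition tarski_eq (G : group) (k : nat) : Prop :=
  tarski_le G k /\ ~ tarski_le G k.-1.

Definition standard_borel (d : measure_display) (X : measurableType d) : Prop :=
  exists f : X -> measurableTypeR Rr,
    injective f /\ measurable_fun setT f /\
    (forall A : set X, measurable A -> measurable (f @` A)).

Definition pmp_free_action (G : group) (d : measure_display) (X : measurableType d)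
    (mu : probability X Rr) (act : G -> X -> X) : Prop :=
  (forall x, act (gone G) x = x) /\
  (forall g h x, act (gmul g h) x = act g (act h x)) /\
  (forall g, measurable_fun setT (act g)) /\
  (forall g (A : set X), measurable A -> mu (act g @^-1` A) = mu A) /\
  mu.-negligible [set x | exists g, g <> gone G /\ act g x = x].

Inductive gconnected (X : Type) (adj : X -> X -> Prop) : X -> X -> Prop :=
| gconn_refl x : gconnected adj x x
| gconn_step x y z : adj x y -> gconnected adj y z -> gconnected adj x z.

Definition graphing_adj (X : Type) (A : nat -> set X) (phi : nat -> X -> X)
  (x y : X) : Prop :=
  exists i, (A i x /\ phi i x = y) \/ (A i y /\ phi i y = x).

(* a countable family (indexed by nat; finitely many by taking empty domains)
   of Borel bijections phi_i : A_i -> B_i between Borel sets, within orbits,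
   whose graph has a.s. the G-orbits as connected components *)
Definition graphing (G : group) (d : measure_display) (X : measurableType d)
    (mu : probability X Rr) (act : G -> X -> X)
    (A B : nat -> set X) (phi : nat -> X -> X) : Prop :=
  (forall i, measurable (A i) /\ measurable (B i) /\
             measurable_fun (A i) (phi i) /\
             {in A i &, injective (phi i)} /\ phi i @` A i = B i) /\
  (forall i x, A i x -> exists g, phi i x = act g x) /\
  {ae mu, forall x, forall y,
     gconnected (graphing_adj A phi) x y <-> exists g, y = act g x}.

Definition graphing_cost (d : measure_display) (X : measurableType d)
    (mu : probability X Rr) (A : nat -> set X) : \bar Rr :=
  (\sum_(0 <= i <oo) mu (A i))%E.

Definition group_cost (G : group) : \bar Rr :=
  ereal_inf [set c | exists (d : measure_display) (X : measurableType d)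
      (mu : probability X Rr) (act : G -> X -> X)
      (A B : nat -> set X) (phi : nat -> X -> X),
      standard_borel X /\ pmp_free_action mu act /\
      graphing mu act A B phi /\ c = graphing_cost mu A].

(* Main.v *)
(** Write S for the generators, and consider the edges g -- g s of the Cayley graph.
    By a countable version of Hall's marriage theorem, translating sets T0, T1 admit
    a paradoxical decomposition as soon as |F0 T0 u F1 T1| >= |F0| + |F1| for all
    finite F0, F1.  Given F0 and F1, let E be the finite graph of the edges used.

    Label the points of a Bernoulli shift by finitely many of their bits, and remove
    from the graphing by the generators every edge whose ends are joined, inside some
    translate of E, by edges of smaller label.  The labels are well founded, so the
    remaining graphing still generates the orbits and its cost is at least 5/2.  Off
    a set of small measure the labels are distinct on the translate of E, so that the
    kept edges form a forest there and are fewer than the vertices.  Integrating, the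
    densities al s of the kept edges satisfy sum_(e in E) al (e's generator) <= |Y| + 1/2,
    where Y is the vertex set of E, and al a + al b + al c >= 5/2 gives Hall's condition
    for {1,a,b}, {1,b,c}.  If a has infinite order, its edges form a forest and can all
    be kept, so al a = 1 and {1,a}, {1,b,c} suffice.

    Conversely two pieces P1, P2 with P1 u P2 t = G are impossible in a torsion group,
    and four pieces yield a free subgroup by ping-pong. *)
Require Import Defs.
From mathcomp Require Import all_boot all_order all_algebra.
From mathcomp Require Import all_classical all_reals all_analysis.
From mathcomp Require Import Rstruct measurable_realfun.
From mathcomp Require Import finmap zify lra.
Set Implicit Arguments. Unset Strict Implicit. Unset Printing Implicit Defensive.
Import Order.TTheory GRing.Theory Num.Theory.
Import numFieldNormedType.Exports.
Local Open Scope classical_set_scope.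
Local Open Scope ring_scope.

(** * Few pieces *)

Lemma gmulVK (G : group) (x y : G) : gmul (ginv x) (gmul x y) = y.
Proof. by rewrite gmulA gmulVl gmul1l. Qed.

Lemma gmulKV (G : group) (x y : G) : gmul x (gmul (ginv x) y) = y.
Proof. by rewrite gmulA gmulVr gmul1l. Qed.

Lemma gmulK (G : group) (x y : G) : gmul (gmul y x) (ginv x) = y.
Proof. by rewrite -gmulA gmulVr gmul1r. Qed.

Lemma gmulVKr (G : group) (x y : G) : gmul (gmul y (ginv x)) x = y.
Proof. by rewrite -gmulA gmulVl gmul1r. Qed.

Lemma gmulI (G : group) (x y z : G) : gmul x y = gmul x z -> y = z.
Proof. by move=> /(congr1 (gmul (ginv x))); rewrite !gmulVK. Qed.

Lemma gmulIr (G : group) (x y z : G) : gmul y x = gmul z x -> y = z.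
Proof. by move=> /(congr1 (fun w => gmul w (ginv x))); rewrite !gmulK. Qed.

Lemma ginvK (G : group) (x : G) : ginv (ginv x) = x.
Proof. by apply: (@gmulI _ (ginv x)); rewrite gmulVr gmulVl. Qed.

Lemma ginvM (G : group) (x y : G) : ginv (gmul x y) = gmul (ginv y) (ginv x).
Proof.
by apply: (@gmulI _ (gmul x y)); rewrite gmulVr gmulA gmulK gmulVr.
Qed.

Lemma ginv1 (G : group) : ginv (gone G) = gone G.
Proof. by apply: (@gmulI _ (gone G)); rewrite gmulVr gmul1l. Qed.

Lemma ginv_inj (G : group) (x y : G) : ginv x = ginv y -> x = y.
Proof. by move=> e; rewrite -(ginvK x) e ginvK. Qed.

Lemma gpowSr (G : group) (x : G) n : gpow x n.+1 = gmul (gpow x n) x.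
Proof.
by elim: n => [|n IH]; [rewrite /= gmul1l gmul1r|rewrite [LHS]/= -gmulA -IH].
Qed.

Lemma mem_rtranslate (G : group) (P : set G) (g x : G) :
  rtranslate P g x <-> P (gmul x (ginv g)).
Proof.
split=> [[p Pp <-]|Px]; first by rewrite gmulK.
by exists (gmul x (ginv g)); rewrite ?gmulVKr.
Qed.

(** A cover of [G] by translates of two pieces, normalised by a translation so that the first piece
    stays in place: [P1] and [P2 t] cover [G]. *)
Definition half_paradox (G : group) (P1 P2 : set G) (t : G) : Prop :=
  forall x, P1 x \/ P2 (gmul x (ginv t)).

Lemma half_paradox_of_cover (G : group) (P : nat -> set G) (g : nat -> G) :
  \bigcup_(i in [set k | (k < 2)%N]) rtranslate (P i) (g i) = setT ->
  half_paradox (P 0%N) (P 1%N) (gmul (g 1%N) (ginv (g 0%N))).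
Proof.
move=> cov x.
have: (\bigcup_(i in [set k | (k < 2)%N]) rtranslate (P i) (g i)) (gmul x (g 0%N)).
  by rewrite cov.
move=> [[|[|//]] _ /mem_rtranslate Px]; first by left; move: Px; rewrite gmulK.
by right; rewrite ginvM ginvK gmulA.
Qed.

Lemma cover1_full (G : group) (P : nat -> set G) (g : nat -> G) :
  \bigcup_(i in [set k | (k < 1)%N]) rtranslate (P i) (g i) = setT -> P 0%N = setT.
Proof.
move=> cov; rewrite -subTset => x _.
have: (\bigcup_(i in [set k | (k < 1)%N]) rtranslate (P i) (g i)) (gmul x (g 0%N)).
  by rewrite cov.
by move=> [[|//] _ /mem_rtranslate]; rewrite gmulK.
Qed.

Lemma cover_nonempty (G : group) n (P : nat -> set G) (g : nat -> G) :
  \bigcup_(i in [set k | (k < n)%N]) rtranslate (P i) (g i) = setT ->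
  exists2 i, (i < n)%N & exists x, P i x.
Proof.
move=> cov; have: (\bigcup_(i in [set k | (k < n)%N]) rtranslate (P i) (g i)) (gone G).
  by rewrite cov.
by move=> [i ni /mem_rtranslate Px]; exists i => //; eexists; exact: Px.
Qed.

Lemma paradoxical_sym (G : group) m n :
  paradoxical_decomposition G m n -> paradoxical_decomposition G n m.
Proof.
move=> [m0 [n0 [P [Q [g [h [dP [dQ [dPQ [cP cQ]]]]]]]]]].
split=> //; split=> //; exists Q, P, h, g; do 4?split=> //.
by move=> i j im jn; rewrite setIC; exact: dPQ.
Qed.

(** A single piece with a translate equal to [G] is already [G] and leaves no room for the other
    family. *)
Lemma paradoxical_ge2 (G : group) m n : paradoxical_decomposition G m n -> (2 <= m)%N.
Proof.
move=> [m0 [n0 [P [Q [g [h [dP [dQ [dPQ [cP cQ]]]]]]]]]].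
case: m m0 dP dPQ cP => [//|[|//]] _ _ dPQ /cover1_full PT.
have [j jn [x Qx]] := cover_nonempty cQ.
have : (P 0%N `&` Q j) x by rewrite PT.
by rewrite dPQ.
Qed.

(** Suppose [P0] and [P1 t] cover [G]. A point of [P1] is not in [P0], so [P1] is stable under right
    multiplication by the inverse of [t]. As [t] has finite order, [P1 t = P1], hence [P0] and [P1]
    cover [G] and no [Q j] can have a point. *)
Lemma torsion_paradoxical_ge3 (G : group) m n : torsion_group G ->
  paradoxical_decomposition G m n -> (3 <= m)%N.
Proof.
move=> tor pd; have := paradoxical_ge2 pd; rewrite leq_eqVlt => /orP[/eqP m2|//].
move: pd; rewrite -m2 => -[_ [n0 [P [Q [g [h [dP [dQ [dPQ [cP cQ]]]]]]]]]].
have := half_paradox_of_cover cP; set t := gmul _ _ => hp.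
have [k [k0 tk]] := tor t.
have stepP x : P 1%N x -> P 1%N (gmul x (ginv t)).
  move=> Px; case: (hp x) => // P0x.
  have : (P 0%N `&` P 1%N) x by [].
  by rewrite dP.
have iterP i x : P 1%N x -> P 1%N (gmul x (gpow (ginv t) i)).
  by elim: i x => [|i IH] x Px /=; rewrite ?gmul1r // gmulA; apply/IH/stepP.
have powV i : gmul (gpow t i) (gpow (ginv t) i) = gone G.
  elim: i => [|i IH]; first by rewrite gmul1l.
  by rewrite gpowSr /= -gmulA gmulKV.
(* After one step by the inverse of [t], another [k - 1] steps complete the period and return to
   [x]. *)
have stepV x : P 1%N (gmul x (ginv t)) -> P 1%N x.
  move=> /(iterP k.-1); rewrite -gmulA.
  rewrite (_ : gmul (ginv t) _ = gone G) ?gmul1r //.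
  rewrite -[LHS]/(gpow (ginv t) k.-1.+1) prednK //.
  by rewrite -[LHS](gmul1l) -tk powV.
have [j jn [x Qx]] := cover_nonempty cQ.
have [i i2 Pix] : exists2 i, (i < 2)%N & P i x.
  by case: (hp x) => [|/stepV]; [exists 0%N|exists 1%N].
have : (P i `&` Q j) x by [].
by rewrite dPQ.
Qed.

Lemma third_letter (l m : bool * bool) : exists2 k, k != l & k != m.
Proof.
case: l m => [[] []] [[] []];
first [by exists (true, true)|by exists (true, false)
      |by exists (false, true)|by exists (false, false)].
Qed.

(* Ping-pong for the right action of G on itself: [D l] is where the letter [l]
   sends the complement of [D] of its inverse letter. *)
Lemma ping_pong (G : group) (t u : G) (D : bool * bool -> set G) :
  (forall k l, k <> l -> D k `&` D l = set0) ->
  (forall l x, ~ D (l.1, ~~ l.2) x -> D l (gmul x (letter_eval t u l))) ->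
  forall w, w != [::] -> reduced_word w -> word_eval t u w <> gone G.
Proof.
move=> dD act w.
have nD k l x : k <> l -> D k x -> ~ D l x.
  by move=> kl Dk Dl; have : (D k `&` D l) x by []; rewrite dD.
have [y0 _] : exists y : G, True by exists (gone G).
have ne l : exists x, D l x.
  apply: contrapT => nl.
  have DT x : D (l.1, ~~ l.2) x.
    by apply: contrapT => /act h; apply: nl; eexists; exact: h.
  have other : D (~~ l.1, true) (gmul y0 (letter_eval t u (~~ l.1, true))).
    by apply: act => /=; apply: nD (DT _) => -[]; case: (l.1).
  by apply: nD (DT _) other => -[]; case: (l.1).
have run w' l x : reduced_word (l :: w') -> ~ D (l.1, ~~ l.2) x ->
    D (last l w') (gmul x (word_eval t u (l :: w'))).
  elim: w' l x => [|k w' IH] l x; first by move=> _ /act; rewrite /= gmul1r.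
  move=> /= /andP[kl red] /act Dx; rewrite gmulA; apply: IH => //.
  apply: nD Dx => e; move: kl; rewrite e /= eqxx /=.
  by case: (k.2).
case: w => [//|l w] _ red.
(* The start lies in a domain [D k] that is neither the one forbidden for the first letter nor the
   one where the path ends, so the word moves [x]. *)
have [k /eqP kl /eqP kw] := third_letter (l.1, ~~ l.2) (last l w).
have [x Dx] := ne k; move=> w1.
have := run w l x red (nD _ _ _ kl Dx); rewrite w1 gmul1r.
exact: nD kw Dx.
Qed.

(** The cover by [P 0] and [P 1 t] says that [t] sends the complement of [P 1] into [P 0] and that
    its inverse sends the complement of [P 0] into [P 1]; likewise for [Q] and [u]. The four
    disjoint pieces are thus ping-pong domains. *)
Lemma paradoxical22_free (G : group) :
  paradoxical_decomposition G 2 2 -> contains_free_subgroup G.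
Proof.
move=> [_ [_ [P [Q [g [h [dP [dQ [dPQ [cP cQ]]]]]]]]]].
have hP := half_paradox_of_cover cP; have hQ := half_paradox_of_cover cQ.
move: (gmul _ _) (gmul _ _) hP hQ => u t hP hQ.
pose D (l : bool * bool) := if l.1 then Q (nat_of_bool l.2) else P (nat_of_bool l.2).
exists t, u; apply: (@ping_pong _ t u D) => [[[] []] [[] []] //= kl|[[] []] x];
  rewrite /D /letter_eval /=.
all: try first [by apply: dP|by apply: dQ|by apply: dPQ|by rewrite setIC; apply: dPQ].
all: move=> n.
- by case: (hQ x).
- by case: (hQ (gmul x u)) => //; rewrite gmulK.
- by case: (hP x).
- by case: (hP (gmul x t)) => //; rewrite gmulK.
Qed.

Lemma torsion_not_tarski5 (G : group) : torsion_group G -> ~ tarski_le G 5.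
Proof.
move=> tor [m [n [mn pd]]].
have := torsion_paradoxical_ge3 tor pd.
have := torsion_paradoxical_ge3 tor (paradoxical_sym pd); lia.
Qed.

Lemma tarski4_free (G : group) : tarski_le G 4 -> contains_free_subgroup G.
Proof.
move=> [m [n [mn pd]]]; apply: paradoxical22_free.
have m2 := paradoxical_ge2 pd; have n2 := paradoxical_ge2 (paradoxical_sym pd).
by move: pd; have [-> ->] : m = 2%N /\ n = 2%N by lia.
Qed.

(** * Hall's marriage theorem for countable families *)

Local Open Scope fset_scope.

Definition hall (L R : choiceType) (N : L -> {fset R}) : Prop :=
  forall I : {fset L}, (#|` I| <= #|` \bigcup_(i <- I) N i|)%N.

Definition fupdate (L : eqType) (R : Type) (N : L -> R) (i : L) (r : R) : L -> R :=
  fun j => if j == i then r else N j.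

(** A set that violates the new condition must contain [i]. [J] is the rest of it, which turns the
    strict inequality into a weak one. *)
Lemma not_hall_update (L R : choiceType) (N : L -> {fset R}) (i : L) (r : {fset R}) :
  hall N -> ~ hall (fupdate N i r) ->
  exists2 J : {fset L}, i \notin J &
    (#|` r `|` \bigcup_(j <- J) N j| <= #|` J|)%N.
Proof.
move=> hN /existsNP[I /negP]; rewrite -ltnNge => lt.
have eqU (K : {fset L}) : i \notin K ->
    \bigcup_(j <- K) fupdate N i r j = \bigcup_(j <- K) N j.
  move=> iK; apply: eq_big_seq => j jK; rewrite /fupdate.
  by case: eqP => // ji; rewrite -ji jK in iK.
case: (boolP (i \in I)) => [iI|iI]; last first.
  by move: lt; rewrite eqU // ltnNge hN.
exists (I `\ i); first by rewrite !inE eqxx.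
move: lt; rewrite (big_fsetD1 i) //= /fupdate eqxx -/(fupdate N i r).
rewrite eqU ?inE ?eqxx //.
by rewrite (cardfsD1 i I) iI add1n ltnS.
Qed.

(* Rado: two elements of one set cannot both be indispensable for Hall's condition. *)
Lemma hall_shrink (L R : choiceType) (N : L -> {fset R}) (i : L) :
  hall N -> (1 < #|` N i|)%N ->
  exists2 r : {fset R}, r `<` N i & hall (fupdate N i r).
Proof.
move=> hN c1.
have [x xN] : exists x, x \in N i by apply/fset0Pn; rewrite -cardfs_gt0; lia.
have [y yN] : exists y, y \in N i `\ x.
  by apply/fset0Pn; rewrite -cardfs_gt0; move: c1; rewrite (cardfsD1 x) xN; lia.
move: yN; rewrite !inE => /andP[yx yN].
apply: contrapT => no.
have nox z : z \in N i -> ~ hall (fupdate N i (N i `\ z)).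
  by move=> zN h; apply: no; exists (N i `\ z) => //; exact: fproperD1.
have [I iI cI] := not_hall_update hN (nox x xN).
have [J iJ cJ] := not_hall_update hN (nox y yN).
(* Since [x] and [y] differ, [A] and [B] together contain [N i]. Hall's condition gives at least
   [1 + |I u J|] elements in the union of [A] and [B] and [|I n J|] in their intersection, against
   [|A| + |B| <= |I| + |J|]. *)
set A := _ `|` _ in cI; set B := _ `|` _ in cJ.
have sU : \bigcup_(j <- i |` (I `|` J)) N j `<=` A `|` B.
  apply/fsubsetP => z /bigfcupP[j /andP[]]; rewrite !inE => + _.
  move=> /or3P[/eqP->|jI|jJ] zN; apply/orP.
  - case: (eqVneq z x) => [->|zx]; last by left; rewrite zN.
    by right; rewrite eq_sym yx xN.
  - by left; apply/orP; right; apply/bigfcupP; exists j; rewrite ?jI.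
  - by right; apply/orP; right; apply/bigfcupP; exists j; rewrite ?jJ.
have sI : \bigcup_(j <- I `&` J) N j `<=` A `&` B.
  apply/fsubsetP => z /bigfcupP[j /andP[]]; rewrite !inE => /andP[jI jJ] _ zN.
  apply/andP; split; apply/orP; right; apply/bigfcupP; exists j => //.
    by rewrite jI.
  by rewrite jJ.
have hU := leq_trans (hN (i |` (I `|` J))) (fsubset_leq_card sU).
have hI := leq_trans (hN (I `&` J)) (fsubset_leq_card sI).
have := cardfsUI A B; have := cardfsUI I J.
move: hU; rewrite cardfsU1 !inE negb_or iI iJ /=; lia.
Qed.

Lemma hall_shrink1 (L R : choiceType) (N : L -> {fset R}) (i : L) :
  hall N -> exists2 r, hall (fupdate N i [fset r]) & r \in N i.
Proof.
move: {2}#|` N i| (leqnn #|` N i|) => n; elim: n N => [|n IH] N cn hN.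
  by have := hN [fset i]; rewrite big_seq_fset1 cardfs1; lia.
have [c1|c1] := ltnP 1 #|` N i|.
  have [r rN hr] := hall_shrink hN c1.
  have e : fupdate N i r i = r by rewrite /fupdate eqxx.
  have [|s hs sr] := IH (fupdate N i r) _ hr.
    by rewrite e; move: (fproper_ltn_card rN); lia.
  exists s; last by apply: (fsubsetP (fproper_sub rN)); rewrite -e.
  move: hs; rewrite (_ : fupdate (fupdate N i r) i _ = fupdate N i [fset s]) //.
  by apply/funext => j; rewrite /fupdate; case: eqP.
have := hN [fset i]; rewrite big_seq_fset1 cardfs1 => ge1.
have /eqP/cardfs1P[r rN] : #|` N i| = 1%N by lia.
exists r; last by rewrite rN inE.
rewrite (_ : fupdate _ _ _ = N) //; apply/funext => j; rewrite /fupdate.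
by case: eqP => // ->.
Qed.

(** The sets are shrunk to singletons one after another along [enum], with Hall's condition
    preserved. The set of [j] is constant once [j] has been treated, and Hall's condition for a pair
    at a late stage makes the two singletons distinct. *)
Theorem countable_hall (L R : choiceType) (N : L -> {fset R}) (enum : nat -> L) :
  (forall i, exists n, enum n = i) -> hall N ->
  exists f : L -> R, injective f /\ forall i, f i \in N i.
Proof.
move=> surj hN.
pose H := {M : L -> {fset R} | hall M}.
pose next (n : nat) (M : H) : H :=
  let w := cid2 (hall_shrink1 (enum n) (projT2 M)) in
  exist _ (fupdate (projT1 M) (enum n) [fset s2val w]) (s2valP w).
pose M n := nat_rect (fun=> H) (exist _ N hN) next n.
have step n j : projT1 (M n.+1) j `<=` projT1 (M n) j.
  rewrite /= /fupdate; case: eqP => [->|_] //=.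
  by rewrite fsub1set; exact: (s2valP' (cid2 (hall_shrink1 (enum n) (projT2 (M n))))).
have mono n m j : (n <= m)%N -> projT1 (M m) j `<=` projT1 (M n) j.
  elim: m => [|m IH]; first by rewrite leqn0 => /eqP->.
  rewrite leq_eqVlt => /orP[/eqP->//|nm].
  by apply: fsubset_trans (IH _); [exact: step|].
have single n : exists r, projT1 (M n.+1) (enum n) = [fset r].
  by rewrite /= /fupdate eqxx; eexists.
have [k kE] := choice surj; have [s sE] := choice single.
have inM j m : (k j < m)%N -> projT1 (M m) j = [fset s (k j)].
  move=> km; have := mono _ _ (enum (k j)) km.
  rewrite sE kE fsubset1 => /orP[/eqP//|/eqP M0].
  by have := projT2 (M m) [fset j]; rewrite big_seq_fset1 M0 cardfs1 cardfs0.
exists (s \o k); split=> [i j /= sij|j].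
  apply: contrapT => ij.
  have [m im jm] : exists2 m, (k i < m)%N & (k j < m)%N.
    by exists (maxn (k i) (k j)).+1; lia.
  have := projT2 (M m) [fset i; j].
  rewrite cardfs2; move/eqP/negPf: (ij) => ->.
  rewrite big_fsetU1 ?big_seq_fset1 ?inE //; last exact/eqP.
  by rewrite !inM // sij /= fsetUid cardfs1.
have := mono 0%N (k j).+1 j; rewrite inM // fsub1set; exact.
Qed.

Local Close Scope fset_scope.

(** * Forests *)

Inductive joined (T : eqType) (E : seq (T * T)) : T -> T -> Prop :=
| joined_refl x : joined E x x
| joined_edge e : e \in E -> joined E e.1 e.2
| joined_sym x y : joined E x y -> joined E y x
| joined_trans x y z : joined E x y -> joined E y z -> joined E x z.

Lemma joined_sub (T : eqType) (E F : seq (T * T)) x y :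
  (forall e, e \in E -> e \in F) -> joined E x y -> joined F x y.
Proof.
move=> EF; elim=> {x y} [x|e eE|x y _|x y z _ xy _ yz].
- exact: joined_refl.
- exact/joined_edge/EF.
- exact: joined_sym.
- exact: joined_trans yz.
Qed.

(** Acyclicity as in Kruskal's algorithm: read from the end of the list, every new edge joins two
    different components. This also excludes loops and repeated edges. *)
Fixpoint forest (T : eqType) (E : seq (T * T)) : Prop :=
  if E is e :: E' then ~ joined E' e.1 e.2 /\ forest E' else True.

(* The map [c] chooses representatives of the components. *)
Lemma forest_components (T : choiceType) (Y : {fset T}) (E : seq (T * T)) :
  forest E -> (forall e, e \in E -> e.1 \in Y /\ e.2 \in Y) ->
  exists c : T -> T, (forall x y, c x = c y -> joined E x y) /\
    (size E + #|` [fset c x | x in Y]%fset| <= #|` Y|)%N.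
Proof.
elim: E => [|e E IH] /=.
  move=> _ _; exists id; split=> [x y ->|]; first exact: joined_refl.
  by rewrite add0n; apply: leq_imfset_card.
move=> [ne fE] sub.
have [|c [cJ cn]] := IH fE; first by move=> e' e'E; apply: sub; rewrite inE e'E orbT.
have JE x y : joined E x y -> joined (e :: E) x y by apply: joined_sub => f fE'; rewrite inE fE' orbT.
have e12 : joined (e :: E) e.1 e.2 by apply: joined_edge; rewrite inE eqxx.
have [e1Y e2Y] := sub e (mem_head _ _).
have ce : c e.1 <> c e.2 by move=> /cJ.
(* The new edge merges two components: the representative [c e.1] is replaced by [c e.2] and
   disappears from the image, which pays for the edge. *)
exists (fun x => if c x == c e.1 then c e.2 else c x); split=> [x y|].
  case: eqP => [x1|_]; case: eqP => [y1|_].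
  - by move=> _; apply: JE; apply: cJ; rewrite x1 y1.
  - move=> y2; apply: (joined_trans (JE _ _ (cJ _ _ x1))).
    by apply: (joined_trans e12); apply/JE/cJ.
  - move=> x2; apply: (joined_trans (JE _ _ (cJ _ _ x2))).
    by apply: (joined_trans (joined_sym e12)); apply/JE/cJ.
  - by move=> xy; apply/JE/cJ.
apply: leq_trans cn; rewrite addSn -addnS leq_add2l.
apply: fproper_ltn_card; rewrite fproperE; apply/andP; split.
  apply/fsubsetP => _ /imfsetP[x xY ->]; case: eqP => _; apply/imfsetP.
    by exists e.2.
  by exists x.
apply/negP => /fsubsetP/(_ (c e.1)) h.
have /h : c e.1 \in [fset c x | x in Y]%fset by apply/imfsetP; exists e.1.
by move=> /imfsetP[x _]; case: eqP => [_ //|xe /esym //].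
Qed.

Lemma forest_size (T : choiceType) (Y : {fset T}) (E : seq (T * T)) :
  forest E -> (forall e, e \in E -> e.1 \in Y /\ e.2 \in Y) ->
  (size E <= #|` Y|)%N.
Proof. by move=> fE sub; have [c [_]] := forest_components fE sub; lia. Qed.

(** * The Bernoulli measure on Cantor space *)

Definition cylinder (w : seq bool) : set (nat -> bool) :=
  [set x | mkseq x (size w) = w].

Definition cylinders : set (set (nat -> bool)) :=
  [set A | A = set0 \/ exists w, A = cylinder w].

Definition cantor : measurableType cylinders.-sigma := g_sigma_algebraType cylinders.

Lemma mkseq_rcons (T : Type) (x : nat -> T) n : mkseq x n.+1 = rcons (mkseq x n) (x n).
Proof. by rewrite /mkseq -addn1 iotaD map_cat cats1. Qed.

Lemma cylinder_rcons w b : cylinder (rcons w b) = cylinder w `&` [set x | x (size w) = b].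
Proof.
apply/seteqP; rewrite /cylinder; split=> x /=; rewrite size_rcons mkseq_rcons.
  by move=> /rcons_inj[].
by move=> [-> ->].
Qed.

(** Two cylinders are nested or disjoint, according to whether the shorter word is a prefix of the
    longer one. *)
Lemma setI_cylinders : setI_closed cylinders.
Proof.
move=> A B [->|[w ->]]; first by left; rewrite set0I.
move=> [->|[v ->]]; first by left; rewrite setI0.
wlog le : w v / (size w <= size v)%N => [wl|].
  by have [/wl//|/ltnW/wl] := leqP (size w) (size v); rewrite setIC.
have eqw (x : nat -> bool) : cylinder v x -> mkseq x (size w) = take (size w) v.
  move=> xv; rewrite -[in RHS]xv /mkseq -map_take take_iota (minn_idPl _) //.
case: (eqVneq (take (size w) v) w) => [vw|/eqP vw].
  right; exists v; apply/seteqP; split=> x => [[]//|xv]; split=> //.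
  by rewrite /cylinder /= eqw.
left; rewrite -subset0 => x [xw xv]; apply: vw; rewrite -[RHS]xw.
by rewrite eqw.
Qed.

Lemma measurable_cylinder w : measurable (cylinder w : set cantor).
Proof. by apply: sub_sigma_algebra; right; exists w. Qed.

Lemma measurable_prefix n (Q : seq bool -> Prop) :
  measurable ([set x | Q (mkseq x n)] : set cantor).
Proof.
rewrite (_ : [set x | _] = \bigcup_(w : seq bool)
    (if `[< Q w /\ size w = n >] then cylinder w else set0)); last first.
  apply/seteqP; split=> x /= => [Qx|[w _]].
    exists (mkseq x n) => //; case: asboolP => [_|[]]; last by rewrite size_mkseq.
    by rewrite /cylinder /= size_mkseq.
  by case: asboolP => // -[Qw <-]; rewrite /cylinder /= => ->.
apply: countable_bigcupT_measurable; first exact: countableP.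
by move=> w; case: asboolP => _; [exact: measurable_cylinder|exact: measurable0].
Qed.

Lemma measurable_coordinate n b : measurable ([set x | x n = b] : set cantor).
Proof.
rewrite (_ : [set x | _] = [set x : nat -> bool | nth false (mkseq x n.+1) n = b]).
  exact: (measurable_prefix n.+1 (fun w => nth false w n = b)).
by apply/seteqP; split=> x /=; rewrite nth_mkseq.
Qed.

Lemma measurable_to_cantor d (T : measurableType d) (f : T -> cantor) :
  (forall n, measurable [set x | f x n = true]) -> measurable_fun setT f.
Proof.
move=> mf; apply: (@measurability _ _ T cantor setT f cylinders erefl).
have mfb n b : measurable [set x | f x n = b].
  case: b => //; rewrite (_ : [set x | _] = ~` [set x | f x n = true]).
    exact: measurableC.
  by apply/seteqP; split=> x /=; case: (f x n).
move=> _ [_ [->|[w ->]] <-]; first by rewrite preimage_set0 setI0.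
rewrite setTI; elim/last_ind: w => [|w b IH].
  by rewrite (_ : _ @^-1` _ = setT) //; apply/seteqP.
by rewrite cylinder_rcons preimage_setI; apply: measurableI; [exact: IH|exact: mfb].
Qed.

Lemma measurable_preimage d d' (T : measurableType d) (T' : measurableType d')
    (f : T -> T') : measurable_fun setT f ->
  forall A, measurable A -> measurable (f @^-1` A).
Proof. by move=> mf A mA; rewrite -[_ @^-1` _]setTI; apply: mf. Qed.

Lemma pushforward_probability d d' (T : measurableType d) (T' : measurableType d')
    (R : realType) (P : probability T R) (f : T -> T') : measurable_fun setT f ->
  exists Q : probability T' R, forall A, Q A = P (f @^-1` A).
Proof.
move=> mf; pose X : {mfun T >-> T'} := mfun_Sub (mem_set mf).
by exists (distribution P X).
Qed.

Lemma cantor_measure_ext (R : realType) (P Q : probability cantor R) :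
  (forall w, P (cylinder w) = Q (cylinder w)) ->
  forall A, measurable A -> P A = Q A.
Proof.
move=> PQ A mA.
apply: (@measure_unique _ _ cantor cylinders (fun=> cylinder [::]) erefl _ _ _ P Q) => //.
- exact: setI_cylinders.
- by move=> _; right; exists [::].
- by apply/seteqP; split=> // x _; exists 0%N.
- by move=> _ [->|[w ->]]; [rewrite (measure0 P) (measure0 Q)|exact: PQ].
- move=> k; apply: (@le_lt_trans _ _ 1%E); last exact: ltry.
  by apply: probability_le1; exact: measurable_cylinder.
Qed.

Definition flip (j : nat) (x : cantor) : cantor := fun n => x n (+) (n == j).

Lemma measurable_flip j : measurable_fun setT (flip j).
Proof.
apply: measurable_to_cantor => n; case: (eqVneq n j) => [nj|nj].
  rewrite (_ : [set x | _] = [set x | x n = false]); first exact: measurable_coordinate.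
  by apply/seteqP; split=> x; rewrite /flip /= nj eqxx; case: (x j).
rewrite (_ : [set x | _] = [set x | x n = true]); first exact: measurable_coordinate.
by apply/seteqP; split=> x; rewrite /flip /= (negbTE nj) addbF.
Qed.

Lemma mkseq_flip_ge j x n : (n <= j)%N -> mkseq (flip j x) n = mkseq x n.
Proof.
move=> nj; apply/eq_in_map => i; rewrite mem_iota /= add0n /flip => ni.
by rewrite (_ : (i == j) = false) ?addbF //; apply/eqP; lia.
Qed.

(** For probabilities this characterises the fair coin measure. In this form, invariance under
    injective reindexing of the bits follows from uniqueness, without product measures. *)
Definition flip_invariant (R : realType) (P : set cantor -> \bar R) : Prop :=
  forall j A, measurable A -> P (flip j @^-1` A) = P A.

(** Flipping the bit after the prefix [w] exchanges its two one-bit extensions, so each of them has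
    half the measure. *)
Lemma flip_invariant_cylinder (R : realType) (P : probability cantor R) w :
  flip_invariant P -> P (cylinder w) = ((2 ^- size w)%:E)%E.
Proof.
move=> inv; elim/last_ind: w => [|w b IH].
  rewrite (_ : cylinder [::] = setT); first by rewrite probability_setT expr0 invr1.
  by apply/seteqP.
have half c : P (cylinder (rcons w c)) = P (cylinder (rcons w (~~ c))).
  rewrite -(inv (size w)); last exact: measurable_cylinder.
  congr (P _); rewrite !cylinder_rcons; apply/seteqP; split=> x /=;
  rewrite /cylinder /= mkseq_flip_ge // /flip eqxx => -[xw xc]; split=> //;
  by move: xc; case: (x _); case: c.
have : P (cylinder w) = (P (cylinder (rcons w true)) + P (cylinder (rcons w false)))%E.
  rewrite -measureU; try exact: measurable_cylinder.
  - congr (P _); rewrite !cylinder_rcons -setIUr setIidl // => x _ /=.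
    by case: (x _); [left|right].
  - rewrite !cylinder_rcons -subset0 => x [[_ /= ->] []] //.
rewrite IH half size_rcons /=.
set p := P _; have pfin : p \is a fin_num.
  by apply: fin_num_measure; exact: measurable_cylinder.
have -> : P (cylinder (rcons w b)) = p by case: b; rewrite // half.
rewrite -(fineK pfin) => -[rE]; congr (_%:E).
by rewrite exprS invfM rE; lra.
Qed.


Lemma flip_invariant_unique (R : realType) (P Q : probability cantor R) :
  flip_invariant P -> flip_invariant Q -> forall A, measurable A -> P A = Q A.
Proof.
by move=> iP iQ; apply: cantor_measure_ext => w; rewrite !flip_invariant_cylinder.
Qed.

Lemma uniform_flip_invariant (R : realType) (P : probability cantor R) :
  (forall w, P (cylinder w) = ((2 ^- size w)%:E)%E) -> flip_invariant P.
Proof.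
move=> PE j; have [Q QE] := pushforward_probability P (measurable_flip j).
move=> A mA; rewrite -QE; apply: cantor_measure_ext => // w; rewrite QE.
have [jw|jw] := ltnP j (size w); last first.
  congr (P _); apply/seteqP; rewrite /cylinder.
  by split=> x /=; rewrite mkseq_flip_ge.
(* The preimage of the cylinder of [w] is that of [w] with bit [j] negated, a word of the same
   length. *)
pose v := set_nth false w j (~~ nth false w j).
have sv : size v = size w by rewrite size_set_nth (maxn_idPr jw).
rewrite (_ : _ @^-1` _ = cylinder v) ?PE ?sv //.
have flipE x i : (i < size w)%N -> nth false (mkseq (flip j x) (size w)) i =
    (nth false (mkseq x (size w)) i) (+) (i == j).
  by move=> iw; rewrite !nth_mkseq.
apply/seteqP; rewrite /cylinder sv; split=> x /= xE.
  apply: (@eq_from_nth _ false); rewrite size_mkseq ?sv // => i iw.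
  have := flipE x i iw; rewrite xE nth_set_nth /=.
  by case: eqP => [->|_] ->; rewrite ?addbT ?addbF ?negbK.
apply: (@eq_from_nth _ false); rewrite size_mkseq // => i iw.
rewrite flipE // xE nth_set_nth /=; case: eqP => [->|_]; last by rewrite addbF.
by rewrite addbT negbK.
Qed.

Definition reindex_seq (s : nat -> nat) (x : cantor) : cantor := x \o s.

Lemma measurable_reindex_seq s : measurable_fun setT (reindex_seq s).
Proof. by apply: measurable_to_cantor => n; exact: (@measurable_coordinate (s n) true). Qed.

(** As [s] is injective, flipping bit [j] after reindexing amounts to flipping bit [s j] before it.
    The image measure is therefore flip invariant, hence equal to [P]. *)
Lemma reindex_seq_invariant (R : realType) (P : probability cantor R) s :
  flip_invariant P -> injective s ->
  forall A, measurable A -> P (reindex_seq s @^-1` A) = P A.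
Proof.
move=> iP inj; have [Q QE] := pushforward_probability P (measurable_reindex_seq s).
move=> A mA; rewrite -QE; apply: flip_invariant_unique => // j B mB.
rewrite !QE -(iP (s j) (reindex_seq s @^-1` B)); last first.
  exact: measurable_preimage (measurable_reindex_seq s) _ mB.
congr (P _); apply/seteqP; split=> x; rewrite /preimage /=;
rewrite (_ : flip j _ = reindex_seq s (flip (s j) x)) //;
by apply/funext => n; rewrite /flip /reindex_seq /= (inj_eq inj).
Qed.

(** * Binary and ternary expansions *)

Fixpoint expansion_map (R : realType) (c : R) (n : nat) (y : R) : R :=
  if n is n'.+1 then
    expansion_map c n' (c * y - (c - 1) * (1 / 2 <= y)%R%:R)
  else y.

(* [digits 2] are binary digits on [[0, 1[]; [digits 3] reads off the ternary
   digits (0 or 2) of the points of the middle-thirds Cantor set. *)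
Definition digits (R : realType) (c y : R) : cantor := fun n => 1 / 2 <= expansion_map c n y.

Lemma measurable_expansion_map (R : realType) (c : R) n : measurable_fun setT (expansion_map c n).
Proof.
elim: n => [|n IH] //=.
apply: (measurableT_comp IH); apply: measurable_funB => //.
apply: measurable_funM; first exact: measurable_cst.
rewrite (_ : (fun y => _) = \1_[set y : R | 1 / 2 <= y]); last first.
  by apply/funext => y; rewrite indicE; congr (_%:R); rewrite mem_setE.
by apply: measurable_indic; rewrite -set_itvcy.
Qed.

Lemma measurable_digits (R : realType) (c : R) : measurable_fun setT (digits c).
Proof.
apply: measurable_to_cantor => n.
rewrite (_ : [set x | _] = setT `&` expansion_map c n @^-1` `[1 / 2, +oo[).
  by apply: measurable_expansion_map.
by rewrite setTI; apply/seteqP; split=> y; rewrite /preimage /digits /= in_itv /= andbT.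
Qed.

Fixpoint dyadic (R : realType) (w : seq bool) : R :=
  if w is b :: w' then (b%:R + dyadic R w') / 2 else 0.

Lemma dyadic_bound (R : realType) w : 0 <= dyadic R w <= 1 - 2 ^- size w.
Proof.
elim: w => [|b w IH] /=; first by rewrite expr0 invr1 subrr lexx.
move: IH; rewrite exprS invfM; move: (2 ^- size w) (dyadic R w) => p q /andP[q0 q1].
by apply/andP; case: b; split => /=; lra.
Qed.

Lemma digits_cons (R : realType) (c y : R) n :
  mkseq (digits c y) n.+1 =
  (1 / 2 <= y) :: mkseq (digits c (c * y - (c - 1) * (1 / 2 <= y)%R%:R)) n.
Proof.
by rewrite /mkseq /= -[1%N]addn0 iotaDl -map_comp.
Qed.

(** The numbers whose binary expansion begins with [w] form a dyadic interval; the induction applies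
    the doubling map once. *)
Lemma binary_cylinder (R : realType) w (y : R) : 0 <= y < 1 ->
  (mkseq (digits 2 y) (size w) == w) = (dyadic R w <= y < dyadic R w + 2 ^- size w).
Proof.
elim: w y => [|b w IH] y y01.
  by rewrite /= expr0 invr1 add0r y01.
rewrite [size _]/= digits_cons exprS invfM eqseq_cons IH; last first.
  by move: y01; have [] := leP (1 / 2) y => /= h /andP[h0 h1]; apply/andP; split; lra.
have := dyadic_bound R w; rewrite /=.
move: (2 ^- size w) (dyadic R w) => p q /andP[q0 q1].
move: y01 => /andP[y0 y1].
have [hy|hy] := leP (1 / 2) y; case: b => /=.
- by apply/andP/andP => -[h0 h1]; split; lra.
- by apply/esym/negP => /andP[h0 h1]; lra.
- by apply/esym/negP => /andP[h0 h1]; lra.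
- by apply/andP/andP => -[h0 h1]; split; lra.
Qed.

Lemma measure_probability d (T : measurableType d) (R : realType)
    (m : {measure set T -> \bar R}) : m setT = 1%E ->
  exists P : probability T R, forall A, P A = m A.
Proof.
move=> m1.
(* Normalising a measure of mass 1 does not change it; [dirac point] is the default for mass zero or
   infinity. *)
exists (mnormalize m (dirac point)) => A.
by rewrite /= /mnormalize m1 /= onee_eq0 /= invr1 mule1.
Qed.

(** The measure is the law of the binary digits of a uniform point of the unit interval. *)
Lemma exists_flip_invariant (R : realType) :
  exists P : probability cantor R, flip_invariant P.
Proof.
have mI : measurable (`[0, 1[ : set R) by exact: measurable_itv.
have [U UE] : exists U : probability (measurableTypeR R) R,
    forall A, U A = mrestr lebesgue_measure mI A.
  apply: measure_probability; rewrite /= /mrestr setTI lebesgue_measure_itv /=.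
  by rewrite lte_fin ltr01 sube0.
have [P PE] := pushforward_probability U (measurable_digits 2).
exists P; apply: uniform_flip_invariant => w; rewrite PE UE /mrestr.
have := dyadic_bound R w; set p := 2 ^- size w => /andP[q0 q1].
have p0 : 0 < p by rewrite invr_gt0 exprn_gt0.
rewrite (_ : _ `&` _ = `[dyadic R w, dyadic R w + p[%classic); last first.
  apply/seteqP; split=> y; rewrite /preimage /cylinder /= !in_itv /=.
    by move=> [/eqP yw y01]; rewrite -binary_cylinder.
  move=> yw; have y01 : 0 <= y < 1.
    by move: yw => /andP[h0 h1]; apply/andP; split; lra.
  by split=> //; apply/eqP; rewrite binary_cylinder.
rewrite lebesgue_measure_itv /= lte_fin ltrDl p0 -EFinB; congr (_%:E).
by rewrite addrC addKr.
Qed.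

Fixpoint ternary_approx (R : realType) (n : nat) (x : cantor) : R :=
  if n is n'.+1 then (2 * (x 0%N)%:R + ternary_approx R n' (fun k => x k.+1)) / 3
  else 0.

Lemma ternary_approx_bound (R : realType) n x : 0 <= ternary_approx R n x <= 1.
Proof.
elim: n x => [|n IH] x /=; first by rewrite lexx ler01.
move: (IH (fun k => x k.+1)) => /andP[h0 h1]; apply/andP.
by case: (x 0%N) => /=; split; lra.
Qed.

Lemma ternary_approx_nd (R : realType) x : nondecreasing_seq (fun n => ternary_approx R n x).
Proof.
apply/nondecreasing_seqP => n; elim: n x => [|n IH] x /=.
  by case: (x 0%N) => /=; lra.
by have /= := IH (fun k => x k.+1); lra.
Qed.

Lemma is_cvg_ternary (R : realType) x : cvgn (fun n => ternary_approx R n x).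
Proof.
apply: nondecreasing_is_cvgn; first exact: ternary_approx_nd.
by exists 1 => _ [n _ <-]; case/andP: (ternary_approx_bound R n x).
Qed.

Definition ternary (R : realType) (x : cantor) : R :=
  limn (fun n => ternary_approx R n x).

Lemma ternary_bound (R : realType) x : 0 <= ternary R x <= 1.
Proof.
apply/andP; split.
  apply: limr_ge; first exact: is_cvg_ternary.
  by near=> n; case/andP: (ternary_approx_bound R n x).
apply: limr_le; first exact: is_cvg_ternary.
by near=> n; case/andP: (ternary_approx_bound R n x).
Unshelve. all: by end_near. Qed.

Lemma ternaryE (R : realType) x :
  ternary R x = (2 * (x 0%N)%:R + ternary R (fun k => x k.+1)) / 3.
Proof.
apply/cvg_lim => //; rewrite -(@cvg_shiftS _ _) /=.
apply: cvgM; last exact: cvg_cst.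
apply: cvgD; first exact: cvg_cst.
exact: is_cvg_ternary.
Qed.

(** A first digit 2 puts the point in the last third of the unit interval and a first digit 0 in the
    first third, so the threshold [1 / 2] tells them apart. *)
Lemma digits_ternary (R : realType) x : digits 3 (ternary R x) = x.
Proof.
apply/funext => n; rewrite /digits; elim: n x => [|n IH] x.
  rewrite ternaryE /=; have /andP[] := ternary_bound R (fun k => x k.+1).
  move: (ternary _ _) => t t0 t1; case: (x 0%N) => /=; first by lra.
  by apply/negbTE; rewrite -ltNge; lra.
rewrite /= -[RHS]/((fun k => x k.+1) n) -IH; congr (_ <= expansion_map _ _ _).
rewrite ternaryE; have /andP[] := ternary_bound R (fun k => x k.+1).
by move: (ternary _ _) => t t0 t1; case: (x 0%N); case: leP => /= h; lra.
Qed.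

Lemma measurable_ternary (R : realType) : measurable_fun setT (ternary R).
Proof.
apply: (@measurable_fun_cvg _ _ _ _ (ternary_approx R)); last first.
  by move=> x _; exact: is_cvg_ternary.
elim=> [|n IH] /=; first exact: measurable_cst.
apply: measurable_funM; last exact: measurable_cst.
apply: measurable_funD.
  apply: measurable_funM; first exact: measurable_cst.
  rewrite (_ : (fun x => _) = \1_[set x : cantor | x 0%N = true]).
    by apply: measurable_indic; exact: (@measurable_coordinate 0%N true).
  apply/funext => x; rewrite indicE; congr (_%:R); apply/esym.
  by case e: (x 0%N); [rewrite mem_set|rewrite memNset //= e].
pose shift (x : cantor) : cantor := fun k => x k.+1.
apply: (measurableT_comp (g := shift) IH).
by apply: measurable_to_cantor => k; exact: (@measurable_coordinate k.+1 true).
Qed.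

(** The embedding [ternary] has the Borel left inverse [digits 3]. The image of [A] is thus a Borel
    set: the [y] with [ternary (digits 3 y) = y] whose digits lie in [A]. *)
Lemma standard_borel_cantor : standard_borel cantor.
Proof.
exists (ternary Rr); split; first exact: can_inj (@digits_ternary Rr).
split; first exact: measurable_ternary.
move=> A mA.
rewrite (_ : _ @` A = [set y | ternary Rr (digits 3 y) = y] `&` digits 3 @^-1` A).
  apply: measurableI; last exact: measurable_preimage (measurable_digits 3) _ mA.
  rewrite (_ : [set y | _] = setT `&` (fun y => ternary Rr (digits 3 y) == y) @^-1` [set true]).
    apply: (measurable_fun_eqr (R := Rr)) => //.
    exact: measurableT_comp (@measurable_ternary Rr) (@measurable_digits Rr 3).
  by rewrite setTI; apply/seteqP; split=> y /= /eqP.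
apply/seteqP; split=> y; first by move=> [x Ax <-]; rewrite /preimage /= digits_ternary.
by move=> [ey Ay]; exists (digits 3 y).
Qed.

(** * The Bernoulli shift of a countable group *)

Fixpoint agree (p q : nat -> nat) (n : nat) : set cantor :=
  if n is n'.+1 then agree p q n' `&` [set x | x (p n') = x (q n')] else setT.

Lemma agreeP p q n x : agree p q n x <-> forall i, (i < n)%N -> x (p i) = x (q i).
Proof.
elim: n => [|n IH] /=; first by split.
split=> [[/IH h xn] i|h]; last by split; [apply/IH => i ni; apply: h; lia|exact: h].
by rewrite ltnS leq_eqVlt => /orP[/eqP->|/h].
Qed.

Lemma measurable_agree p q n : measurable (agree p q n).
Proof.
elim: n => [|n IH] /=; first exact: measurableT.
apply: measurableI => //.
rewrite (_ : [set x | _] = \bigcup_(b : bool)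
    ([set x : cantor | x (p n) = b] `&` [set x | x (q n) = b])).
  apply: countable_bigcupT_measurable; first exact: countableP.
  by move=> b; apply: measurableI; exact: measurable_coordinate.
apply/seteqP; split=> x /= => [e|[b _ [-> ->]] //].
by exists (x (q n)).
Qed.

(** Flipping bit [q n] exchanges agreement and disagreement at [n] and touches none of the earlier
    comparisons, so each further comparison halves the measure. *)
Lemma agree_measure (R : realType) (P : probability cantor R) p q n :
  flip_invariant P -> injective q -> (forall i j, p i <> q j) ->
  P (agree p q n) = ((2 ^- n)%:E)%E.
Proof.
move=> inv qinj pq; elim: n => [|n IH].
  by rewrite probability_setT expr0 invr1.
have mA := measurable_agree p q; have mS := mA n.+1.
have mD : measurable (agree p q n `\` agree p q n.+1) by exact: measurableD.
have half : P (agree p q n `\` agree p q n.+1) = P (agree p q n.+1).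
  rewrite -(inv (q n) (agree p q n.+1)) //; congr (P _); apply/seteqP.
  have fp x i : flip (q n) x (p i) = x (p i).
    by rewrite /flip (_ : _ == _ = false) ?addbF //; apply/eqP/pq.
  have fq x i : flip (q n) x (q i) = x (q i) (+) (i == n).
    by rewrite /flip (inj_eq qinj).
  have fA x : agree p q n (flip (q n) x) <-> agree p q n x.
    split=> /agreeP h; apply/agreeP => i ni; move: (h i ni); rewrite fp fq;
    by rewrite (_ : i == n = false) ?addbF //; apply/eqP; lia.
  split=> x; rewrite /preimage /=.
    move=> [An nA]; split; first exact/fA.
    rewrite fp fq eqxx; apply: contrapT => ne; apply: nA; split=> //=.
    by move: ne; case: (x (p n)); case: (x (q n)) => // /(_ erefl).
  move=> [/fA An]; rewrite fp fq eqxx => e; split=> // -[_ e'].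
  by move: e; rewrite e'; case: (x (q n)).
have : P (agree p q n) = (P (agree p q n.+1) + P (agree p q n `\` agree p q n.+1))%E.
  rewrite -measureU //.
    by congr (P _); rewrite setDUK //; move=> x [].
  exact: setDIK.
rewrite IH half; have := fin_num_measure P _ mS.
move=> /fineK <- -[rE]; congr (_%:E).
by rewrite exprS invfM rE; lra.
Qed.

Lemma le_geometric_eq0 (R : realType) (r : R) :
  0 <= r -> (forall n, r <= 2 ^- n) -> r = 0.
Proof.
move=> r0 rn; apply/eqP; rewrite eq_le r0 andbT leNgt; apply/negP => rp.
have := archi_boundP (ltW (x := 0) (y := r^-1) _); rewrite invr_gt0 => /(_ rp).
set n := Num.bound _ => nr.
have n2 : (n%:R : R) < 2 ^+ n by rewrite -natrX ltr_nat ltn_expl.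
have : r^-1 < r^-1.
  apply: lt_le_trans (lt_trans nr n2) _.
  by rewrite -[2 ^+ n]invrK lef_pV2 ?posrE ?invr_gt0 ?exprn_gt0.
by rewrite ltxx.
Qed.

(** This arranges the bits of a point of [cantor] as infinitely many bits at each element of [T].
    With infinitely many bits per element the Bernoulli shift is almost surely free even for a
    finite group. *)
Lemma countable_prod_nat_bij (T : Type) (t0 : T) : countable [set: T] ->
  exists (e : T * nat -> nat) (d : nat -> T * nat), cancel e d /\ cancel d e.
Proof.
move=> /countable_injP[code codeI].
have /card_set_bijP[f] : ([set: T * nat] #= [set: nat])%card.
  apply: eq_card_nat.
    apply/countable_injP; exists (fun p => choice.pickle (code p.1, p.2)) => -[x m] [y n] _ _.
    move=> /(pcan_inj (@choice.pickleK _)) /= [xy ->].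
    by have -> : x = y by apply: codeI; rewrite ?in_setT.
  move=> /(finite_image snd); rewrite (_ : _ @` _ = setT); first exact: infinite_nat.
  by apply/seteqP; split=> // n _; exists (t0, n).
by rewrite setTT_bijective => -[d ed de]; exists f, d.
Qed.

Lemma countable_enum (T : Type) (t0 : T) : countable [set: T] ->
  exists f : nat -> T, forall x, exists n, f n = x.
Proof.
move=> /countable_injP[code codeI].
have /choice[f fE] : forall n, exists y, forall x, code x = n -> y = x.
  move=> n; have [[x xn]|no] := pselect (exists x, code x = n); last first.
    by exists t0 => x xn; exfalso; apply: no; exists x.
  by exists x => y yn; apply: codeI; rewrite ?in_setT // xn yn.
by exists f => x; exists (code x); apply: fE.
Qed.

Theorem bernoulli_action (G : group) : countable [set: G] ->
  exists (mu : probability cantor Rr) (act : G -> cantor -> cantor),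
    pmp_free_action mu act.
Proof.
move=> cG; have [e [d [ed de]]] := countable_prod_nat_bij (gone G) cG.
have [mu inv] := exists_flip_invariant Rr.
pose s g n := e (gmul (ginv g) (d n).1, (d n).2).
have sinj g : injective (s g).
  move=> m n /(can_inj ed) [/gmulI mn1 mn2]; apply: (can_inj de).
  by rewrite (surjective_pairing (d m)) mn1 mn2 -surjective_pairing.
exists mu, (fun g => reindex_seq (s g)); split; [|split; [|split; [|split]]].
- move=> x; apply/funext => n; rewrite /reindex_seq /= /s; congr (x _).
  by rewrite ginv1 gmul1l -surjective_pairing de.
- move=> g h x; apply/funext => n; rewrite /reindex_seq /= /s; congr (x (e _)).
  by rewrite ed /= ginvM gmulA.
- by move=> g; exact: measurable_reindex_seq.
- by move=> g A mA; exact: reindex_seq_invariant.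
have [f fs] := countable_enum (gone G) cG.
pose F g : set cantor := [set x | g <> gone G /\ reindex_seq (s g) x = x].
have : mu.-negligible (\bigcup_n F (f n)).
  apply: negligible_bigcup => n; move: (f n) => g {n}.
  have [->|g1] := pselect (g = gone G).
    have -> : F (gone G) = set0 by rewrite -subset0 => x [].
    exact: negligible_set0.
  (* A point fixed by [g] has the same bits at the identity and at the inverse of [g]. These are
     disjoint families of coordinates, so the event is null. *)
  pose p n := e (gone G, n); pose q n := e (ginv g, n).
  have qinj : injective q by move=> m n /(can_inj ed) [].
  have pq i j : p i <> q j.
    move=> /(can_inj ed) [g1' _]; apply: g1; apply: ginv_inj; by rewrite -g1' ginv1.
  exists (\bigcap_n agree p q n).
  have mI : measurable (\bigcap_n agree p q n).
    by apply: bigcapT_measurable => n; exact: measurable_agree.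
  split=> //.
    have fin := fin_num_measure mu _ mI; rewrite -[LHS](fineK fin); congr (_%:E).
    apply: le_geometric_eq0 => [|n]; first by rewrite fine_ge0.
    rewrite -lee_fin fineK // -(agree_measure n inv qinj pq).
    apply: le_measure; [exact: mem_set|apply/mem_set; exact: measurable_agree|].
    by move=> x; apply.
  move=> x [_ xE] n _; apply/agreeP => i _.
  by rewrite -[in LHS]xE /reindex_seq /= /s ed /= gmul1r.
apply: negligibleS => x [g g1x]; have [n gn] := fs g.
by exists n => //; rewrite /F /= gn.
Qed.

(** * Removing redundant edges *)

Lemma gconnected_trans (X : Type) (adj : X -> X -> Prop) x y z :
  gconnected adj x y -> gconnected adj y z -> gconnected adj x z.
Proof. by elim=> // u v w uv _ IH /IH; apply: gconn_step. Qed.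

Lemma gconnected_sym (X : Type) (adj : X -> X -> Prop) x y :
  (forall u v, adj u v -> adj v u) -> gconnected adj x y -> gconnected adj y x.
Proof.
move=> adjC; elim=> {x y} [x|x y z xy _ yz]; first exact: gconn_refl.
apply: gconnected_trans yz _; apply: gconn_step (adjC _ _ xy) _; exact: gconn_refl.
Qed.

(** The filtered list takes finitely many values, so [Q] may be arbitrary; it will be connectedness
    by the edges of smaller label. *)
Lemma measurable_filter_set d (X : measurableType d) (T : Type) (p : X -> T -> bool)
    (Q : seq T -> Prop) (E : seq T) :
  (forall e, measurable [set y | p y e]) -> measurable [set y | Q [seq f <- E | p y f]].
Proof.
move=> mp; elim: E Q => [|e E IH] Q /=.
  have [q|nq] := pselect (Q [::]).
    have -> : [set _ : X | Q [::]] = setT by apply/seteqP; split=> // y _.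
    exact: measurableT.
  have -> : [set _ : X | Q [::]] = set0 by rewrite -subset0.
  exact: measurable0.
rewrite (_ : [set _ | _] =
   ([set y | p y e] `&` [set y | Q (e :: [seq f <- E | p y f])]) `|`
   (~` [set y | p y e] `&` [set y | Q [seq f <- E | p y f]])).
  apply: measurableU; (apply: measurableI; last by [exact: (IH (fun s => Q (e :: s)))|exact: IH]).
    exact: mp.
  exact: measurableC.
apply/seteqP; split=> y /=; first by case: (p y e); [left|right].
by case: (p y e) => -[[]|[]].
Qed.

Lemma measurable_exists_mem d (X : measurableType d) (T : eqType) (R : X -> T -> Prop)
    (E : seq T) :
  (forall e, measurable [set y | R y e]) ->
  measurable [set y | exists2 e, e \in E & R y e].
Proof.
move=> mR; elim: E => [|e E IH].
  by rewrite (_ : [set _ | _] = set0) // -subset0 => y [].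
rewrite (_ : [set _ | _] = [set y | R y e] `|` [set y | exists2 e, e \in E & R y e]).
  exact: measurableU.
apply/seteqP; split=> y /=.
  move=> [f]; rewrite inE => /orP[/eqP->|fE] Rf; [by left|by right; exists f].
move=> [Re|[f fE Rf]]; first by exists e; rewrite ?mem_head.
by exists f; rewrite // inE fE orbT.
Qed.

Lemma measurable_prefix2 n (Q : seq bool -> seq bool -> Prop) (f g : cantor -> cantor) :
  measurable_fun setT f -> measurable_fun setT g ->
  measurable [set x | Q (mkseq (f x) n) (mkseq (g x) n)].
Proof.
move=> mf mg.
rewrite (_ : [set x | _] = \bigcup_(w : seq bool)
   (f @^-1` [set x | mkseq x n = w] `&` g @^-1` [set x | Q w (mkseq x n)])).
  apply: countable_bigcupT_measurable; first exact: countableP.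
  move=> w; apply: measurableI.
    exact: measurable_preimage mf _ (@measurable_prefix n (fun v => v = w)).
  exact: measurable_preimage mg _ (@measurable_prefix n (Q w)).
apply/seteqP; split=> x; rewrite /preimage /=; last by move=> [w _ [->]].
by exists (mkseq (f x) n).
Qed.

Lemma eventually_none (T : eqType) (R : T -> nat -> Prop) (L : seq T) :
  (forall e, e \in L -> exists m, forall n, (m <= n)%N -> ~ R e n) ->
  exists m, forall n, (m <= n)%N -> forall e, e \in L -> ~ R e n.
Proof.
elim: L => [|e L IH] h; first by exists 0%N.
have [m1 h1] := h e (mem_head _ _).
have [|m2 h2] := IH; first by move=> f fL; apply: h; rewrite inE fL orbT.
exists (maxn m1 m2) => n; rewrite geq_max => /andP[n1 n2] f.
by rewrite inE => /orP[/eqP->|]; [exact: h1|exact: h2].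
Qed.

(** The left side is the integral of the number of [e] with [x] in [F e]. That number is at most [n]
    off [B] and at most [size E] on [B]. *)
Lemma sum_measure_le d (X : measurableType d) (P : probability X Rr) (T : Type)
    (F : T -> set X) (B : set X) (E : seq T) (n : nat) :
  (forall e, measurable (F e)) -> measurable B ->
  (forall x, ~ B x -> (count (fun e => `[< F e x >]) E <= n)%N) ->
  \sum_(e <- E) fine (P (F e)) <= n%:R + (size E)%:R * fine (P B).
Proof.
move=> mF mB cnt.
have mind A : measurable A -> measurable_fun setT (fun x : X => (\1_A x)%:E : \bar Rr).
  by move=> mA; apply/measurable_EFinP; apply: measurable_indic.
have fin A : measurable A -> P A = (fine (P A))%:E.
  by move=> mA; rewrite fineK //; apply: fin_num_measure.
rewrite -lee_fin EFinD EFinM -fin //.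
rewrite -sumEFin.
under eq_bigr do rewrite -fin // -(setIT (F _)) -integral_indic //.
rewrite -ge0_integral_sum //; last by move=> e; apply: mind.
have -> : (n%:R%:E + (size E)%:R%:E * P B =
    \int[P]_x (n%:R%:E + (size E)%:R%:E * (\1_B x)%:E))%E.
  rewrite ge0_integralD //; last first.
    by apply: measurable_funeM; apply: mind.
  rewrite integral_cst //= (_ : P setT = 1%E) ?mule1; last exact: probability_setT.
  congr (_ + _)%E.
  rewrite ge0_integralZl //; last exact: mind.
  by rewrite integral_indic // setIT.
apply: ge0_le_integral => //.
- by move=> x _; apply: sume_ge0 => e _; rewrite lee_fin indicE.
- by apply: emeasurable_sum => e; apply: mind.
- by apply: emeasurable_funD => //; apply: measurable_funeM; apply: mind.
move=> x _; rewrite sumEFin -EFinM -EFinD lee_fin.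
have -> : \sum_(e <- E) \1_(F e) x = (count (fun e => `[< F e x >]) E)%:R :> Rr.
  elim: E {cnt} => [|e E IH]; first by rewrite big_nil.
  by rewrite big_cons IH /= natrD indicE.
rewrite indicE; have [/mem_set-> |nB] := pselect (B x).
  by rewrite mulr1 -natrD ler_nat; apply: leq_trans (count_size _ _) (leq_addl _ _).
by rewrite memNset // mulr0 addr0 ler_nat; exact: cnt.
Qed.

(* If z holds, the edges of the generator [S 0] get the label 0 and are never removed. *)
Definition edge_label (z : bool) (i : nat) (w : seq bool) : nat :=
  if z && (i == 0%N) then 0%N else (choice.pickle (i, w)).+1.

Lemma edge_label_inj z i j w v : ~~ (z && (i == 0%N)) ->
  edge_label z i w = edge_label z j v -> i = j /\ w = v.
Proof.
rewrite /edge_label => /negbTE->; case: ifP => // _ [].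
by move=> /(pcan_inj (@choice.pickleK _)) [].
Qed.

Section Pruning.
Context (G : group) (S : nat -> G) (z : bool) (M : nat) (act : G -> cantor -> cantor).
Context (E : seq ({classic G} * nat)).

(** The inverse turns right multiplication in the Cayley graph into the left action: the edge from
    [g] to [g (S i)] becomes an application of [step_map i]. *)
Definition vertex (x : cantor) (g : G) : cantor := act (ginv g) x.

Definition edge_ends (e : {classic G} * nat) : {classic G} * {classic G} :=
  (e.1, gmul e.1 (S e.2)).

Definition label_at (x : cantor) (e : {classic G} * nat) : nat :=
  edge_label z e.2 (mkseq (vertex x e.1) M).

Definition lower_edges (x : cantor) (n : nat) : seq ({classic G} * {classic G}) :=
  [seq edge_ends e | e <- [seq e <- E | (label_at x e < n)%N]].

(* Seen from the base point [act e.1 y], the point y is the vertex e.1 of the finite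
   graph E; its edge i is redundant if its ends are joined by edges of E of smaller label. *)
Definition removed (i : nat) : set cantor :=
  [set y | exists2 e, e \in E & e.2 = i /\
     joined (lower_edges (act e.1 y) (edge_label z i (mkseq y M)))
       (edge_ends e).1 (edge_ends e).2].

Definition kept (i : nat) : set cantor :=
  if (i < 3)%N then ~` removed i else set0.

Definition step_map (i : nat) : cantor -> cantor := act (ginv (S i)).

Context (act1 : forall x, act (gone G) x = x).
Context (actM : forall g h x, act (gmul g h) x = act g (act h x)).
Context (mact : forall g, measurable_fun setT (act g)).
Context (E3 : forall e, e \in E -> (e.2 < 3)%N).

Lemma actVK g x : act (ginv g) (act g x) = x.
Proof. by rewrite -actM gmulVl act1. Qed.

Lemma actKV g x : act g (act (ginv g) x) = x.
Proof. by rewrite -actM gmulVr act1. Qed.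

Lemma vertexM x g h : vertex x (gmul g h) = act (ginv h) (vertex x g).
Proof. by rewrite /vertex ginvM actM. Qed.

Lemma measurable_removed i : measurable (removed i).
Proof.
apply: measurable_exists_mem => e.
have [ei|ni] := eqVneq e.2 i; last first.
  rewrite (_ : [set _ | _] = set0); first exact: measurable0.
  by rewrite -subset0 => y [/eqP]; rewrite (negbTE ni).
rewrite (_ : [set _ | _] = [set y | (fun s => joined [seq edge_ends f | f <- s]
     (edge_ends e).1 (edge_ends e).2)
  [seq f <- E | (label_at (act e.1 y) f < edge_label z i (mkseq y M))%N]]).
  apply: (measurable_filter_set
     (fun s => joined [seq edge_ends f | f <- s] (edge_ends e).1 (edge_ends e).2)) => f.
  apply: (measurable_prefix2 (f := fun y => vertex (act e.1 y) f.1) (g := id) M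
     (fun v w => (edge_label z f.2 v < edge_label z i w)%N)); last exact: measurable_id.
  exact: measurableT_comp (mact _) (mact _).
by apply/seteqP; split=> y /=; [case|split].
Qed.

Lemma measurable_kept i : measurable (kept i).
Proof.
rewrite /kept; case: ifP => _; last exact: measurable0.
by apply: measurableC; exact: measurable_removed.
Qed.

Notation adj := (graphing_adj kept step_map).

Lemma adj_sym x y : adj x y -> adj y x.
Proof. by move=> [i [h|h]]; exists i; [right|left]. Qed.

(** Induction on the label: a removed edge is bypassed by edges of smaller label, whose ends are
    connected by induction even if they were removed too. *)
Lemma step_connected i y : (i < 3)%N -> gconnected adj y (step_map i y).
Proof.
move: {2}(edge_label z i (mkseq y M)).+1 (ltnSn (edge_label z i (mkseq y M))) => n.
elim: n i y => [//|n IH] i y le i3.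
have [k|nk] := pselect (kept i y).
  by apply: gconn_step (gconn_refl _ _); exists i; left.
have [e eE [ei]] : removed i y.
  by apply: contrapT => nr; apply: nk; rewrite /kept i3.
set x := act e.1 y => J.
have lift u v : joined (lower_edges x (edge_label z i (mkseq y M))) u v ->
    gconnected adj (vertex x u) (vertex x v).
  elim=> {u v} [u|f|u v _|u v w _ uv _ vw].
  - exact: gconn_refl.
  - move=> /mapP[h]; rewrite mem_filter => /andP[lh hE] ->.
    rewrite /= vertexM; apply: IH; last exact: E3.
    by move: lh le; rewrite /label_at; lia.
  - exact/gconnected_sym/adj_sym.
  - exact: gconnected_trans vw.
by move: (lift _ _ J); rewrite /= vertexM ei /vertex actVK.
Qed.

Lemma orbit_connected x g : generated (fun u => exists2 i, (i < 3)%N & u = S i) g ->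
  gconnected adj x (act g x).
Proof.
move=> gen; elim: gen x => {g} [g [i i3 ->]||g h _ IHg _ IHh|g _ IH] x.
- have := step_connected (act (S i) x) i3; rewrite /step_map actVK.
  exact/gconnected_sym/adj_sym.
- by rewrite act1; exact: gconn_refl.
- by rewrite actM; apply: gconnected_trans (IHh x) (IHg _).
- have := IH (act (ginv g) x); rewrite actKV.
  exact/gconnected_sym/adj_sym.
Qed.

Lemma connected_orbit x y : gconnected adj x y -> exists g, y = act g x.
Proof.
elim=> {x y} [x|x y w [i xy] _ [g ->]]; first by exists (gone G).
case: xy => -[_ e].
  by exists (gmul g (ginv (S i))); rewrite actM -e.
by exists (gmul g (S i)); rewrite actM -e /step_map actKV.
Qed.

Lemma kept_graphing (mu : probability cantor Rr) :
  (forall g, generated (fun u => exists2 i, (i < 3)%N & u = S i) g) ->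
  graphing mu act kept (fun i => step_map i @` kept i) step_map.
Proof.
move=> gen; split; [|split].
- move=> i; split; first exact: measurable_kept.
  split; last first.
    split; first by apply: measurable_funTS; exact: mact.
    by split=> // x y _ _ xy; rewrite -(actKV (S i) x) -(actKV (S i) y) -/(step_map i x) xy.
  rewrite (_ : _ @` _ = act (S i) @^-1` kept i).
    exact: measurable_preimage (mact _) _ (measurable_kept i).
  apply/seteqP; split=> y; rewrite /preimage /=.
    by move=> [x kx <-]; rewrite /step_map actKV.
  by move=> ky; exists (act (S i) y) => //; rewrite /step_map actVK.
- by move=> i x _; exists (ginv (S i)).
apply: aeW => x y; split; first exact: connected_orbit.
by move=> [g ->]; exact: orbit_connected.
Qed.

Definition separated (x : cantor) : Prop :=
  forall e f, e \in E -> f \in E -> mkseq (vertex x e.1) M = mkseq (vertex x f.1) M ->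
  e.1 = f.1.

(** The only edge of generator [S 0] that leaves the half-line [g], [g s^-1], [g s^-2], ..., where
    [s] is [S 0], is the one at [g], which is not in [L]. As [s] has infinite order, [g s] is not on
    this half-line. *)
Lemma power_path_not_joined (L : seq ({classic G} * nat)) (g : {classic G}) :
  infinite_order (S 0%N) -> (forall e, e \in L -> e.2 = 0%N /\ e.1 <> g) ->
  ~ joined [seq edge_ends e | e <- L] g (gmul g (S 0%N)).
Proof.
move=> inf hL.
pose B (h : G) := exists n, h = gmul g (gpow (ginv (S 0%N)) n).
have inv u v : joined [seq edge_ends e | e <- L] u v -> B u <-> B v.
  elim=> {u v} [//|_ /mapP[e /hL[e0 eg] ->]|u v _ IH|u v w _ IH1 _ IH2].
  - rewrite /= e0; split=> -[n].
      case: n => [|n]; first by rewrite /= gmul1r.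
      by rewrite gpowSr gmulA => ->; exists n; rewrite gmulVKr.
    move=> en; exists n.+1; rewrite gpowSr gmulA -en gmulK //.
  - by split=> /IH.
  - by split=> [/IH1/IH2|/IH2/IH1].
move=> /inv[+ _] => /(_ _)[|n].
  by exists 0%N; rewrite /= gmul1r.
move=> /gmulI sn; apply: (inf n.+1) => //=.
rewrite {1}sn; elim: n {sn} => [|n IH]; first by rewrite gmul1l.
by rewrite [gpow (S 0%N) n.+1]/= gpowSr -gmulA gmulVK.
Qed.

(** The edges come by decreasing label. Separation makes the labels of different edges distinct,
    apart from the label 0, so all later edges have smaller labels than a given one and cannot join
    its ends, because it was kept. *)
Lemma kept_forest (K : seq ({classic G} * nat)) (x : cantor) :
  (z -> infinite_order (S 0%N)) -> separated x ->
  uniq K -> sorted (fun e f => (label_at x f <= label_at x e)%N) K ->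
  (forall e, e \in K -> e \in E /\ kept e.2 (vertex x e.1)) ->
  forest [seq edge_ends e | e <- K].
Proof.
move=> zinf sep; elim: K => [//|e K IH] /= /andP[eK uK] srt hK.
split; last first.
  apply: IH => //; first exact: path_sorted srt.
  by move=> f fK; apply: hK; rewrite inE fK orbT.
have le f : f \in K -> (label_at x f <= label_at x e)%N.
  move=> fK; have tr : transitive (fun e f => (label_at x f <= label_at x e)%N).
    by move=> a b c ab bc; apply: leq_trans bc ab.
  by move: srt => /(order_path_min tr) /allP; apply.
have [eE ke] := hK e (mem_head _ _).
have hE f : f \in K -> f \in E by move=> fK; have [] := hK f; rewrite ?inE ?fK ?orbT.
(* After an edge of label 0 all others have label 0 as well, so they are edges of [S 0] elsewhere
   and the half-line argument applies. *)
have [/andP[zz /eqP e0]|nz] := boolP (z && (e.2 == 0%N)).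
  rewrite e0; apply: power_path_not_joined; first exact: zinf.
  have lab0 : label_at x e = 0%N by rewrite /label_at /edge_label zz e0.
  move=> f fK; have := le f fK; rewrite lab0 leqn0 /label_at /edge_label zz /=.
  case: ifP => [/eqP f0 _|_ //]; split=> // fe; move: eK.
  by rewrite (_ : e = f) ?fK // (surjective_pairing e) (surjective_pairing f) fe e0 f0.
move=> J; move: ke; rewrite /kept E3 //; apply.
exists e => //; split=> //.
have -> : act e.1 (vertex x e.1) = x by rewrite /vertex actKV.
apply: joined_sub J => _ /mapP[f fK ->]; apply: map_f; rewrite mem_filter hE // andbT.
rewrite ltn_neqAle le // andbT; apply/eqP => /esym lef.
have [ef vf] := edge_label_inj nz lef.
move: eK; rewrite (_ : e = f) ?fK // (surjective_pairing e) (surjective_pairing f) ef.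
by rewrite (sep e f) // hE.
Qed.

Lemma kept_count (Y : {fset {classic G}}) (x : cantor) :
  (z -> infinite_order (S 0%N)) -> separated x -> uniq E ->
  (forall e, e \in E -> (edge_ends e).1 \in Y /\ (edge_ends e).2 \in Y) ->
  (count (fun e => `[< kept e.2 (vertex x e.1) >]) E <= #|` Y|)%N.
Proof.
move=> zinf sep uE EY; rewrite -size_filter.
pose r (e f : {classic G} * nat) := (label_at x f <= label_at x e)%N.
set K := seq.filter _ _.
rewrite -(size_sort r) -(size_map edge_ends).
have hK e : e \in sort r K -> e \in E /\ kept e.2 (vertex x e.1).
  by rewrite mem_sort mem_filter => /andP[/asboolP].
apply: forest_size.
  apply: (kept_forest zinf sep) => //; first by rewrite sort_uniq filter_uniq.
  by apply: sort_sorted => e f; rewrite /r leq_total.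
by move=> _ /mapP[e /hK[eE _] ->]; exact: EY.
Qed.

End Pruning.

(** * Densities of kept edges *)

Lemma countable_surj (T U : Type) (f : U -> T) :
  countable [set: U] -> (forall t, exists u, f u = t) -> countable [set: T].
Proof.
move=> cU sf; rewrite (_ : [set: T] = f @` setT); last first.
  by apply/esym/seteqP; split=> // t _; have [u <-] := sf t; exists u.
by apply: sub_countable cU; exact: card_image_le.
Qed.

Definition signed_letter (G : group) (S : nat -> G) (l : nat * bool) : G :=
  if l.2 then ginv (S l.1) else S l.1.

Definition signed_word (G : group) (S : nat -> G) (w : seq (nat * bool)) : G :=
  foldr (fun l g => gmul (signed_letter S l) g) (gone G) w.

Lemma signed_word_cat (G : group) (S : nat -> G) w v :
  signed_word S (w ++ v) = gmul (signed_word S w) (signed_word S v).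
Proof. by elim: w => [|l w IH] /=; rewrite ?gmul1l // IH gmulA. Qed.

Lemma generated_countable (G : group) (S : nat -> G) :
  (forall g, generated (fun u => exists2 i, (i < 3)%N & u = S i) g) ->
  countable [set: G].
Proof.
move=> gen; apply: (countable_surj (f := signed_word S)); first exact: countableP.
move=> g; elim: (gen g) => {g} [g [i _ ->]||g h _ [w <-] _ [v <-]|g _ [w <-]].
- by exists [:: (i, false)]; rewrite /= gmul1r.
- by exists [::].
- by exists (w ++ v); rewrite signed_word_cat.
elim: w => [|l w [v vE]]; first by exists [::]; rewrite /= ginv1.
exists (v ++ [:: (l.1, ~~ l.2)]).
rewrite signed_word_cat /= gmul1r vE ginvM; congr gmul.
by rewrite /signed_letter /=; case: l.2; rewrite //= ginvK.
Qed.

Lemma generated_sub (G : group) (P Q : G -> Prop) g :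
  (forall u, P u -> Q u) -> generated P g -> generated Q g.
Proof.
move=> PQ; elim=> {g} [g /PQ Qg||g h _ IHg _ IHh|g _ IHg].
- exact: gen_base.
- exact: gen_one.
- exact: gen_mul.
- exact: gen_inv.
Qed.

Section Coincidence.
Context (G : group) (act : G -> cantor -> cantor) (mu : probability cantor Rr).
Context (pmp : pmp_free_action mu act).

Definition coincidence (L : seq ({classic G} * {classic G})) (M : nat) : set cantor :=
  [set x | exists2 p, p \in L & p.1 <> p.2 /\
     mkseq (vertex act x p.1) M = mkseq (vertex act x p.2) M].

Lemma measurable_coincidence L M : measurable (coincidence L M).
Proof.
have [_ [_ [mact _]]] := pmp.
apply: measurable_exists_mem => p.
have [e|ne] := pselect (p.1 = p.2).
  rewrite (_ : [set _ | _] = set0); first exact: measurable0.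
  by rewrite -subset0 => x [].
rewrite (_ : [set _ | _] = [set x |
    mkseq (act (ginv p.1) x) M = mkseq (act (ginv p.2) x) M]).
  exact: (measurable_prefix2 M (fun v w => v = w) (mact _) (mact _)).
by apply/seteqP; split=> x /=; [case|split].
Qed.

Lemma coincidence_nonincreasing L : nonincreasing_seq (coincidence L).
Proof.
move=> m n mn; apply/subsetPset => x [p pL [p12 e]]; exists p => //; split=> //.
move: (congr1 (take m) e); rewrite /mkseq -!map_take !take_iota (minn_idPl mn).
by [].
Qed.

Lemma bigcap_coincidence_null L : mu (\bigcap_M coincidence L M) = 0%E.
Proof.
have [act1 [actM [mact [_ free]]]] := pmp.
apply/negligibleP.
  by apply: bigcapT_measurable => M; exact: measurable_coincidence.
apply: negligibleS free => x xL /=.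
apply: contrapT => nfree.
have [|m hm] := @eventually_none ({classic G} * {classic G})%type (fun p M => p.1 <> p.2 /\
     mkseq (vertex act x p.1) M = mkseq (vertex act x p.2) M) L.
  move=> p pL.
  have [e|ne] := pselect (p.1 = p.2); first by exists 0%N => n _ [].
  have [n nE] : exists n, vertex act x p.1 n <> vertex act x p.2 n.
    apply: contrapT => no; apply: nfree.
    have e : vertex act x p.1 = vertex act x p.2.
      by apply/funext => n; apply: contrapT => ne'; apply: no; exists n.
    exists (gmul p.1 (ginv p.2)); split.
      by move=> e1; apply: ne; apply: (@gmulIr _ (ginv p.2)); rewrite e1 gmulVr.
    by rewrite actM -[X in act _ X]e /vertex -actM gmulVr act1.
  exists n.+1 => k nk [_ ek]; apply: nE.
  by rewrite -(nth_mkseq false (vertex act x p.1) nk) ek nth_mkseq.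
have [p pL hp] := xL m I.
exact: hm (leqnn m) p pL hp.
Qed.

Lemma coincidence_small L (eps : Rr) : 0 < eps ->
  exists M, fine (mu (coincidence L M)) < eps.
Proof.
move=> eps0; apply: contrapT => no.
have ge M : (eps%:E <= mu (coincidence L M))%E.
  have fin := fin_num_measure mu _ (measurable_coincidence L M).
  rewrite -(fineK fin) lee_fin leNgt; apply/negP => lt.
  by apply: no; exists M.
have cvg := nonincreasing_cvg_mu (mu := mu) (F := coincidence L) _
  (measurable_coincidence L) _ (@coincidence_nonincreasing L).
have {}cvg : mu \o coincidence L @ \oo --> 0%E.
  rewrite -(bigcap_coincidence_null L); apply: cvg.
    apply: (@le_lt_trans _ _ 1%E); last exact: ltry.
    by apply: probability_le1; exact: measurable_coincidence.
  by apply: bigcapT_measurable => M; exact: measurable_coincidence.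
have : (eps%:E <= 0)%E.
  rewrite -(cvg_lim _ cvg) //; apply: lime_ge.
    by apply/cvg_ex; exists 0%E.
  by near=> n; exact: ge.
by rewrite lee_fin leNgt eps0.
Unshelve. all: by end_near. Qed.

End Coincidence.

Lemma generated_by3_gen (G : group) (a b c : G) : generated_by3 a b c ->
  forall g, generated (fun u => exists2 i, (i < 3)%N & u = nth c [:: a; b] i) g.
Proof.
move=> gen g; apply: generated_sub (gen g) => u.
by move=> [->|[->|->]]; [exists 0%N|exists 1%N|exists 2%N].
Qed.

Lemma forest_density (G : group) (S : nat -> G) (z : bool)
    (E : seq ({classic G} * nat)) (Y : {fset {classic G}}) :
  (forall g, generated (fun u => exists2 i, (i < 3)%N & u = S i) g) ->
  ((5 / 2 : Rr)%:E <= group_cost G)%E ->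
  (z -> infinite_order (S 0%N)) -> uniq E -> (forall e, e \in E -> (e.2 < 3)%N) ->
  (forall e, e \in E -> (edge_ends S e).1 \in Y /\ (edge_ends S e).2 \in Y) ->
  exists al : nat -> Rr, [/\ forall i, al i <= 1,
    5 / 2 <= al 0%N + al 1%N + al 2%N, (z -> al 0%N = 1) &
    \sum_(e <- E) al e.2 <= #|` Y|%:R + 1 / 2].
Proof.
move=> gen cost zinf uE E3 EY.
have [mu [act pmp]] := bernoulli_action (generated_countable gen).
have [act1 [actM [mact [inv free]]]] := pmp.
have eps0 : 0 < (1 / 2) / ((size E)%:R + 1) :> Rr by rewrite divr_gt0 // ltr_wpDl.
pose L := [seq (e.1, f.1) | e <- E, f <- E].
have [M small] := coincidence_small pmp L eps0.
pose A := kept S z M act E.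
have mA i : measurable (A i) by exact: measurable_kept.
have fin i : mu (A i) = (fine (mu (A i)))%:E.
  by rewrite fineK //; exact: fin_num_measure.
exists (fun i => fine (mu (A i))); split.
- by move=> i; rewrite -lee_fin -fin; exact: probability_le1.
- rewrite -lee_fin !EFinD -!fin; apply: le_trans cost _.
  apply: ereal_inf_lbound.
  exists _, cantor, mu, act, A, (fun i => step_map S act i @` A i), (step_map S act).
  split; first exact: standard_borel_cantor.
  split=> //; split; first exact: kept_graphing.
  rewrite /graphing_cost (@nneseries_split _ _ 0%N 3%N) //.
  have tail : (\sum_(3 <= i <oo) mu (A i) = 0)%E.
    by apply: eseries0 => i i3 _; rewrite /A /kept ltnNge i3 measure0.
  by rewrite add0n tail adde0 /index_iota /= !big_cons big_nil adde0 addeA.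
- move=> zz; rewrite (_ : A 0%N = setT) ?probability_setT //.
  apply/seteqP; split=> // y _; rewrite /A /kept /= => -[e _ [e0]].
  rewrite /edge_label zz eqxx /= /lower_edges.
  rewrite (eq_filter (a2 := pred0)) ?filter_pred0; last by move=> f; rewrite ltn0.
  rewrite e0; exact: (@power_path_not_joined _ _ [::] e.1 (zinf zz)).
pose F (e : {classic G} * nat) := [set x | A e.2 (vertex act x e.1)].
have FE e : mu (F e) = mu (A e.2) := inv (ginv e.1) _ (mA e.2).
have mF e : measurable (F e) by exact: measurable_preimage (mact (ginv e.1)) _ (mA e.2).
have := @sum_measure_le _ _ mu _ F (coincidence act L M) E #|` Y| mF.
move=> /(_ (measurable_coincidence pmp L M)).
have cnt x : ~ coincidence act L M x -> (count (fun e => `[< F e x >]) E <= #|` Y|)%N.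
  move=> nc; apply: (kept_count (z := z) (M := M) act1 actM) => //.
  move=> e f eE fE ef; apply: contrapT => ne; apply: nc.
  by exists (e.1, f.1) => //; apply/allpairsP; exists (e, f).
move=> /(_ cnt); under eq_bigr do rewrite FE.
move=> /le_trans; apply; rewrite lerD2l.
have s0 : (0 : Rr) <= (size E)%:R by [].
move: small; rewrite ltr_pdivlMr; last by lra.
have : 0 <= fine (mu (coincidence act L M)) by rewrite fine_ge0.
by nra.
Qed.

(** * Paradoxical decompositions *)

Lemma layered_density (G : group) (S : nat -> G) (z : bool)
    (F : nat -> {fset {classic G}}) (Y : {fset {classic G}}) :
  (forall g, generated (fun u => exists2 i, (i < 3)%N & u = S i) g) ->
  ((5 / 2 : Rr)%:E <= group_cost G)%E ->
  (z -> infinite_order (S 0%N)) ->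
  (forall i (g : {classic G}), (i < 3)%N -> g \in F i ->
     g \in Y /\ (gmul g (S i) : {classic G}) \in Y) ->
  exists al : nat -> Rr, [/\ forall i, al i <= 1,
    5 / 2 <= al 0%N + al 1%N + al 2%N, (z -> al 0%N = 1) &
    al 0%N * #|` F 0%N|%:R + al 1%N * #|` F 1%N|%:R + al 2%N * #|` F 2%N|%:R
      <= #|` Y|%:R + 1 / 2].
Proof.
move=> gen cost zinf FY.
pose E : seq ({classic G} * nat) := [seq (g, i) | i <- iota 0 3, g <- enum_fset (F i)].
have [|e /allpairsPdep[i [g [i3 gF ->]]]|e /allpairsPdep[i [g [i3 gF ->]]]|al [al1 al52 alz sum]] :=
  @forest_density G S z E Y gen cost zinf.
- apply: allpairs_uniq_dep; [by []|by move=> i _; exact: fset_uniq|].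
  by move=> [i g] [j h] _ _ /= [-> ->].
- by move: i3; rewrite mem_iota.
- by apply: FY => //; move: i3; rewrite mem_iota.
exists al; split=> //; apply: le_trans sum.
rewrite big_allpairs_dep /= !big_cons big_nil addr0 addrA.
by rewrite !big_const_seq !count_predT !iter_addr_0 !mulr_natr.
Qed.

Lemma weight_bound33 (R : realFieldType) (x0 x1 x2 p q u : R) :
  x0 <= 1 -> x1 <= 1 -> x2 <= 1 -> 5 / 2 <= x0 + x1 + x2 ->
  0 <= p <= u -> 0 <= q <= u -> p + q <= x0 * p + x1 * u + x2 * q.
Proof.
move=> h0 h1 h2 h /andP[p0 pu] /andP[q0 qu].
have : (1 - x0) * p <= (1 - x0) * u by apply: ler_wpM2l => //; lra.
have : (1 - x2) * q <= (1 - x2) * u by apply: ler_wpM2l => //; lra.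
have : 0 <= (x0 + x1 + x2 - 2) * u by apply: mulr_ge0; lra.
by lra.
Qed.

Lemma weight_bound23 (R : realFieldType) (x1 x2 p q : R) :
  5 / 2 <= 1 + x1 + x2 -> 0 <= q -> p + q <= 1 * p + x1 * q + x2 * q.
Proof.
move=> h q0; have : 0 <= (x1 + x2 - 1) * q by apply: mulr_ge0; lra.
by lra.
Qed.

Lemma natr_le_half (R : realFieldType) (m n : nat) : (m%:R : R) <= n%:R + 1 / 2 -> (m <= n)%N.
Proof.
move=> h; rewrite -ltnS -(ltr_nat R) -addn1 natrD.
by apply: le_lt_trans h _; rewrite ltrD2l; lra.
Qed.

Definition translate_fset (G : group) (T : bool -> seq G) (i : {classic G} * bool) :
    {fset {classic G}} :=
  [fset (gmul i.1 (s : {classic G}) : {classic G}) | s in (T i.2 : seq {classic G})]%fset.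

Definition fiber (G : group) (I : {fset {classic G} * bool}) (b : bool) :
    {fset {classic G}} :=
  [fset p.1 | p in I & p.2 == b]%fset.

Lemma mem_fiber (G : group) (I : {fset {classic G} * bool}) b g :
  (g \in fiber I b) = ((g, b) \in I).
Proof.
apply/imfsetP/idP => [[[h c]]|gI].
  by rewrite !inE /= => /andP[hI /eqP <-] ->.
by exists (g, b); rewrite // !inE /= gI eqxx.
Qed.

Lemma card_fibers (G : group) (I : {fset {classic G} * bool}) :
  (#|` I| <= #|` fiber I false| + #|` fiber I true|)%N.
Proof.
pose tag b := [fset (g, b) | g in fiber I b]%fset.
have sub : (I `<=` tag false `|` tag true)%fset.
  apply/fsubsetP => -[g b] gI; rewrite inE; apply/orP.
  by case: b gI => gI; [right|left]; apply/imfsetP; exists g; rewrite //= mem_fiber.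
apply: leq_trans (fsubset_leq_card sub) _.
rewrite cardfsU; apply: leq_trans (leq_subr _ _) _.
by apply: leq_add; exact: leq_imfset_card.
Qed.

Lemma mem_translates (G : group) (T : bool -> seq G) (I : {fset {classic G} * bool})
    b (g s : {classic G}) :
  g \in fiber I b -> s \in (T b : seq {classic G}) ->
  (gmul g s : {classic G}) \in (\bigcup_(i <- I) translate_fset T i)%fset.
Proof.
rewrite mem_fiber => gI sT; apply/bigfcupP; exists (g, b); first by rewrite gI.
by apply/imfsetP; exists s.
Qed.

Lemma hall_paradoxical (G : group) (T : bool -> seq G) : countable [set: G] ->
  (forall b, (0 < size (T b))%N) -> hall (translate_fset T) ->
  paradoxical_decomposition G (size (T false)) (size (T true)).
Proof.
move=> cG T0 hT.
have [e [d [ed de]]] := countable_prod_nat_bij (gone G) cG.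
have [|f [finj fT]] :=
  countable_hall (enum := fun n => (((d n).1 : {classic G}), (d n).2 == 0%N)) _ hT.
  move=> [g b]; exists (e (g, nat_of_bool (~~ b))); rewrite ed /=.
  by case: b.
have /choice[k kE] : forall i, exists k, (k < size (T i.2))%N /\
    f i = gmul i.1 (nth (gone G) (T i.2) k).
  move=> i; have /imfsetP[s /= sT fE] := fT i.
  exists (index (s : {classic G}) (T i.2 : seq {classic G})); rewrite index_mem; split=> //.
  by rewrite fE (nth_index (T := {classic G})).
pose P b j : set G := [set x | exists2 g, k (g, b) = j & x = f (g, b)].
have dis b c i j : (b, i) <> (c, j) -> P b i `&` P c j = set0.
  move=> ne; rewrite -subset0 => x [[g gi ->] [h hj /finj[gh bc]]]; apply: ne.
  by rewrite -gi -hj gh bc.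
have cov b : \bigcup_(j in [set k | (k < size (T b))%N])
    rtranslate (P b j) (ginv (nth (gone G) (T b) j)) = setT.
  apply/seteqP; split=> // g _; have [kb fg] := kE (g, b).
  exists (k (g, b)) => //; exists (f (g, b)); first by exists g.
  by rewrite fg /= gmulK.
split; first exact: T0; split; first exact: T0.
exists (P false), (P true), (fun j => ginv (nth (gone G) (T false) j)),
  (fun j => ginv (nth (gone G) (T true) j)).
split; first by move=> i j _ _ ij; apply: dis => -[].
split; first by move=> i j _ _ ij; apply: dis => -[].
by split; first by move=> i j _ _; exact: dis.
Qed.

Lemma cost_paradoxical33 (G : group) (a b c : G) : generated_by3 a b c ->
  ((5 / 2 : Rr)%:E <= group_cost G)%E -> paradoxical_decomposition G 3 3.
Proof.
move=> /generated_by3_gen gen cost.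
pose T (t : bool) := if t then [:: gone G; b; c] else [:: gone G; a; b].
apply: (@hall_paradoxical G T); [exact: generated_countable gen|by case|].
move=> I; set Y := (\bigcup_(i <- I) _)%fset.
have nz : false -> infinite_order (nth c [:: a; b] 0) by [].
pose F (i : nat) := nth (fiber I true) [:: fiber I false; fiber I false `|` fiber I true]%fset i.
have [i g i3 gF|al [al1 al52 _ sum]] :=
  @layered_density G _ false F Y gen cost nz.
  have inY t (s : {classic G}) : g \in fiber I t -> s \in (T t : seq {classic G}) ->
      g \in Y /\ (gmul g s : {classic G}) \in Y.
    move=> gt sT; split; last exact: mem_translates gt sT.
    have := @mem_translates _ T I t g (gone G : {classic G}) gt.
    by rewrite gmul1r; apply; case: (t); rewrite inE eqxx.
  case: i i3 gF => [|[|[|//]]] _ /=.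
  - by move=> gF; apply: (inY false) => //; rewrite !inE eqxx orbT.
  - by rewrite inE => /orP[] gF; [apply: (inY false)|apply: (inY true)];
      rewrite // !inE eqxx !orbT.
  - by move=> gF; apply: (inY true) => //; rewrite !inE eqxx !orbT.
apply: leq_trans (card_fibers I) _.
have pu : (#|` fiber I false| <= #|` (fiber I false `|` fiber I true)%fset|)%N.
  exact/fsubset_leq_card/fsubsetUl.
have qu : (#|` fiber I true| <= #|` (fiber I false `|` fiber I true)%fset|)%N.
  exact/fsubset_leq_card/fsubsetUr.
apply: (@natr_le_half Rr); apply: le_trans sum; rewrite natrD /F /=.
by apply: weight_bound33; rewrite ?ler0n ?ler_nat.
Qed.

Lemma cost_paradoxical23 (G : group) (a b c : G) : generated_by3 a b c ->
  ((5 / 2 : Rr)%:E <= group_cost G)%E -> infinite_order a ->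
  paradoxical_decomposition G 2 3.
Proof.
move=> /generated_by3_gen gen cost inf.
pose T (t : bool) := if t then [:: gone G; b; c] else [:: gone G; a].
apply: (@hall_paradoxical G T); [exact: generated_countable gen|by case|].
move=> I; set Y := (\bigcup_(i <- I) _)%fset.
pose F (i : nat) := nth (fiber I true) [:: fiber I false] i.
have [i g i3 gF|al [al1 al52 /(_ isT) al0 sum]] :=
  @layered_density G _ true F Y gen cost (fun=> inf).
  have inY t (s : {classic G}) : g \in fiber I t -> s \in (T t : seq {classic G}) ->
      g \in Y /\ (gmul g s : {classic G}) \in Y.
    move=> gt sT; split; last exact: mem_translates gt sT.
    have := @mem_translates _ T I t g (gone G : {classic G}) gt.
    by rewrite gmul1r; apply; case: (t); rewrite inE eqxx.
  case: i i3 gF => [|[|[|//]]] _ /= gF.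
  - by apply: (inY false) => //; rewrite !inE eqxx orbT.
  - by apply: (inY true) => //; rewrite !inE eqxx !orbT.
  - by apply: (inY true) => //; rewrite !inE eqxx !orbT.
apply: leq_trans (card_fibers I) _.
apply: (@natr_le_half Rr); apply: le_trans sum; rewrite natrD /F /= al0.
by apply: weight_bound23 => //; move: al52; rewrite al0.
Qed.

Lemma tarski_le_add (G : group) m n :
  paradoxical_decomposition G m n -> tarski_le G (m + n).
Proof. by exists m, n. Qed.

Lemma generated_by3_sub (G : group) (a b c a' b' c' : G) : generated_by3 a b c ->
  (forall u, u = a \/ u = b \/ u = c -> u = a' \/ u = b' \/ u = c') ->
  generated_by3 a' b' c'.
Proof. by move=> gen sub g; exact: generated_sub (gen g). Qed.

Theorem theorem3 (G : group) (a b c : G) :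
  generated_by3 a b c ->
  ((5 / 2 : Rr)%:E <= group_cost G)%E ->
  (tarski_le G 6 /\ (torsion_group G -> tarski_eq G 6)) /\
  ((infinite_order a \/ infinite_order b \/ infinite_order c) ->
     tarski_le G 5 /\ (~ contains_free_subgroup G -> tarski_eq G 5)).
Proof.
move=> gen cost.
have le6 : tarski_le G 6 := tarski_le_add (cost_paradoxical33 gen cost).
split; first by split=> // tor; split=> //; exact: torsion_not_tarski5.
move=> inf; have le5 : tarski_le G 5.
  apply: (@tarski_le_add G 2 3); case: inf => [|[|]].
  - exact: cost_paradoxical23 gen cost.
  - by apply: (@cost_paradoxical23 G b a c) => //; apply: generated_by3_sub gen _ => u; tauto.
  - by apply: (@cost_paradoxical23 G c a b) => //; apply: generated_by3_sub gen _ => u; tauto.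
by split=> // nofree; split=> // /tarski4_free.
Qed.
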